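(* Let $G$ be a locally compact group. The space $GL_0(G)$ is left (respectively right) topologically introverted in $GL(G)$; that is, $m f\in GL_0(G)$ (respectively $f m\in GL_0(G)$) for all $m\in GL_0(G)^*$ and all $f\in GL_0(G)$.
   Context: $M(G)$ is the measure algebra of complex regular Borel measures on $G$ with total variation norm and convolution $*$. A generalised function is a family $f=(f_\mu)_{\mu\in M(G)}\in\prod_{\mu\in M(G)}L^\infty(|\mu|)$ such that $f_\mu=f_\nu$ $|\mu|$-a.e. whenever $\mu\ll\nu$ (meaning $|\mu|$ is absolutely continuous with respect to $|\nu|$). $GL(G)$ is the commutative unital C$^*$-algebra of all generalised functions, with coordinatewise operations, involution $(f_\mu)\mapsto(\overline{f_\mu})$ and norm $\|f\|_\infty=\sup_\mu\|f_\mu\|_{\mu,\infty}<\infty$ (where $\|\cdot\|_{\mu,\infty}$ is the $L^\infty(|\mu|)$ norm). The map $f\mapsto(\zeta\mapsto\langle f,\zeta\rangle=\int_G f_\zeta\,d\zeta)$ is an isometric linear bijection of $GL(G)$ onto $M(G)^*$, and $GL(G)$ and $M(G)^*$ are identified through it. For $\zeta\in M(G)$ and $f\in GL(G)$, $\zeta\circ f$ and $f\circ\zeta$ are the generalised functions with $\langle\zeta\circ f,\mu\rangle=\langle f,\zeta*\mu\rangle$ and $\langle f\circ\zeta,\mu\rangle=\langle f,\mu*\zeta\rangle$ for all $\mu\in M(G)$. A generalised function $f=(f_\mu)$ vanishes at infinity if for each $\varepsilon>0$ there is a compact $K_\varepsilon\subseteq G$ with $\|f_\mu\chi_{G\setminus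 K_\varepsilon}\|_{\mu,\infty}<\varepsilon$ for all $\mu\in M(G)$; $GL_0(G)$ is the C$^*$-subalgebra of $GL(G)$ of all generalised functions vanishing at infinity. If $f\in GL_0(G)$ and $\zeta\in M(G)$ then $\zeta\circ f$ and $f\circ\zeta$ lie in $GL_0(G)$. For $m\in GL_0(G)^*$ and $f\in GL_0(G)$, the elements $mf,fm\in M(G)^*=GL(G)$ are defined by $\langle mf,\zeta\rangle=\langle m,\zeta\circ f\rangle$ and $\langle fm,\zeta\rangle=\langle m,f\circ\zeta\rangle$ for $\zeta\in M(G)$. *)

(* Defs.v *)
From HB Require Import structures.
From mathcomp Require Import all_boot all_order all_algebra.
From mathcomp Require Import complex.
From mathcomp Require Import all_classical all_reals all_analysis.

Set Implicit Arguments.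
Unset Strict Implicit.
Unset Printing Implicit Defensive.

Import Order.TTheory GRing.Theory Num.Theory.
Import numFieldNormedType.Exports.
Import Normc.

Local Open Scope ring_scope.
Local Open Scope complex_scope.
Local Open Scope classical_set_scope.

(* Topological groups, not necessarily commutative (topologicalZmodType is
   additive and commutative). The Pointed component is only there because
   measurableType requires it. *)
HB.mixin Record isTopologicalGroup G of PointedTopological G & Group G := {
  mulg_continuous : continuous (fun x : G * G => (x.1 * x.2)%g) ;
  invg_continuous : continuous (fun x : G => (x^-1)%g)
}.

#[short(type="topologicalGroupType")]
HB.structure Definition TopologicalGroup :=
  {G of PointedTopological G & Group G & isTopologicalGroup G}.

Notation borel G := (g_sigma_algebraType (@open G)).

Section complex_measures.
Context (R : realType) (G : topologicalGroupType).
Implicit Types (A E : set (borel G)) (p q : {charge set (borel G) -> \bar R}).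

(* value at E of the complex measure p + iq *)
Definition cval p q E : R[i] := fine (p E) +i* fine (q E).

(* total variation |p + iq| : the supremum of \sum_i |mu (F i)| over the
   countable Borel partitions F of E *)
Definition tvar p q E : \bar R :=
  ereal_sup [set s | exists F : nat -> set (borel G),
    [/\ forall i, measurable (F i), trivIset setT F, \bigcup_i F i = E &
        s = (\sum_(0 <= i <oo) (normc (cval p q (F i)))%:E)%E]].

Definition regular_cmeasure p q := forall E (e : R), measurable E -> 0 < e ->
  exists K U : set G, [/\ compact K, open U, K `<=` E, E `<=` U &
                        (tvar p q (U `\` K) < e%:E)%E].

(* M(G). Values on non-Borel sets are irrelevant to everything below. *)
Record cmeasure := CMeasure {
  cm_re : {charge set (borel G) -> \bar R} ;
  cm_im : {charge set (borel G) -> \bar R} ;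
  cm_regular : regular_cmeasure cm_re cm_im }.

HB.instance Definition _ := gen_eqMixin cmeasure.
HB.instance Definition _ := gen_choiceMixin cmeasure.

Definition cm_val (mu : cmeasure) E : R[i] := cval (cm_re mu) (cm_im mu) E.

Definition tv (mu : cmeasure) E : \bar R := tvar (cm_re mu) (cm_im mu) E.

Lemma regular_czero : regular_cmeasure czero czero.
Proof.
move=> E e mE e0; exists set0, setT; split => //.
- exact: compact0.
- exact: openT.
- apply: (@le_lt_trans _ _ 0%E); last by rewrite lte_fin.
  apply: ge_ereal_sup => _ [F [_ _ _ ->]].
  rewrite eseries0// => i _ _.
  by rewrite /cval /= /czero/= expr0n /= addr0 sqrtr0.
Qed.

Definition cm0 : cmeasure := CMeasure regular_czero.

(* \int g dp = \int g dp+ - \int g dp-, for a Jordan decomposition of p *)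
Definition charge_int p (g : borel G -> R) : R :=
  let hP := cid (Hahn_decomposition p) in
  let hN := cid (svalP hP) in
  Rintegral (jordan_pos (svalP hN)) setT g
  - Rintegral (jordan_neg (svalP hN)) setT g.

Definition cm_int (mu : cmeasure) (g : borel G -> R[i]) : R[i] :=
  let u x := complex.Re (g x) in let v x := complex.Im (g x) in
  (charge_int (cm_re mu) u - charge_int (cm_im mu) v)
  +i* (charge_int (cm_re mu) v + charge_int (cm_im mu) u).

(* (mu * nu)(E) = \int nu(x^-1 E) dmu(x) for all Borel sets E. This determines
   mu * nu on Borel sets; the default cm0 is never used when G is locally
   compact and Hausdorff, since the regular measure mu * nu then exists. *)
Definition convol (mu nu : cmeasure) : cmeasure :=
  xget cm0 [set la | forall E, measurable E ->
    cm_val la E = cm_int mu (fun x : G => cm_val nu [set y : G | E (x * y)%g])].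

Definition cmeasurable (g : borel G -> R[i]) :=
  measurable_fun setT (fun x => complex.Re (g x)) /\
  measurable_fun setT (fun x => complex.Im (g x)).

Definition Linf_norm (mu : cmeasure) (g : borel G -> R[i]) : \bar R :=
  ereal_inf [set b%:E | b in [set b : R | 0 <= b /\
    \forall x \ae tv mu, normc (g x) <= b]].

Definition Linf (mu : cmeasure) (g : borel G -> R[i]) :=
  cmeasurable g /\ (Linf_norm mu g < +oo)%E.

(* Families of representatives: equality of generalised functions is
   coordinatewise almost everywhere equality. *)
Definition gfamily := cmeasure -> borel G -> R[i].

(* GL(G) *)
Definition GL : set gfamily := [set f |
  (forall mu, Linf mu (f mu)) /\
  (forall mu nu, tv mu `<< tv nu -> f mu = f nu %[ae tv mu])].

Definition GL_norm (f : gfamily) : \bar R :=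
  ereal_sup [set Linf_norm mu (f mu) | mu in setT].

Definition vanishes_at_infinity (f : gfamily) := forall e : R, 0 < e ->
  exists2 K : set G, compact K & forall mu,
    (Linf_norm mu (fun x => (f mu x * (\1_(~` K) x)%:C)%R) < e%:E)%E.

Definition GL0 : set gfamily := [set f | GL f /\ vanishes_at_infinity f].

Definition pairing (f : gfamily) (ze : cmeasure) : R[i] := cm_int ze (f ze).

(* f is the generalised function identified with the functional Phi on M(G) *)
Definition represents (f : gfamily) (Phi : cmeasure -> R[i]) :=
  GL f /\ forall ze, pairing f ze = Phi ze.

(* The generalised function identified with Phi, when Phi belongs to M(G)^*:
   it then exists because GL(G) -> M(G)^* is onto, and is unique up to almost
   everywhere equality. *)
Definition GL_of (Phi : cmeasure -> R[i]) : gfamily :=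
  xget (fun _ _ => 0) [set f | represents f Phi].

Definition lact (ze : cmeasure) (f : gfamily) : gfamily :=
  GL_of (fun mu => pairing f (convol ze mu)).

Definition ract (f : gfamily) (ze : cmeasure) : gfamily :=
  GL_of (fun mu => pairing f (convol mu ze)).

(* m restricts to a bounded linear functional on GL_0(G). Boundedness makes m
   insensitive to the choice of representatives. *)
Definition GL0_dual (m : gfamily -> R[i]) :=
  (forall (a : R[i]) f g, GL0 f -> GL0 g ->
     m (fun mu x => a * f mu x + g mu x) = a * m f + m g) /\
  (exists C : R, forall f, GL0 f -> ((normc (m f))%:E <= C%:E * GL_norm f)%E).

(* mf and fm, as functionals on M(G) *)
Definition dual_lmul (m : gfamily -> R[i]) (f : gfamily) : cmeasure -> R[i] :=
  fun ze => m (lact ze f).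

Definition dual_rmul (f : gfamily) (m : gfamily -> R[i]) : cmeasure -> R[i] :=
  fun ze => m (ract f ze).

(* Phi, a functional on M(G), lies in GL_0(G) under the identification of
   M(G)^* with GL(G) *)
Definition in_GL0 (Phi : cmeasure -> R[i]) :=
  exists2 h : gfamily, GL0 h & represents h Phi.

Definition left_introverted := forall m f,
  GL0_dual m -> GL0 f -> in_GL0 (dual_lmul m f).

Definition right_introverted := forall m f,
  GL0_dual m -> GL0 f -> in_GL0 (dual_rmul f m).

End complex_measures.

(* Main.v *)
(** A generalised function f amounts to the bounded additive functional
    a |-> \int f_a da on positive regular measures. Conversely, given such a functional
    phi, f_a is the Radon-Nikodym density of E |-> phi(a|E) with respect to a; that f_a
    also serves for b << a is checked on the level sets of db/da. In these terms f
    vanishes at infinity iff for every eps some compact K satisfies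
    |phi(a)| <= eps |a| for all a null on K.

    Let m be in GL_0(G)^*. A functional m cannot act independently on many disjoint
    regions, so m is carried, up to eps, by some compact K_0. If |f| < eps off the
    compact K_f, and ze is null on the compact set K_0^-1 K_f \cup K_f K_0^-1, then the
    convolution of ze with any measure carried by K_0, on either side, is null on K_f.
    Hence ze o f and f o ze are small on K_0, and m(ze o f), m(f o ze) are small: mf and
    fm vanish at infinity. *)

From HB Require Import structures.
Require Import Defs.
From mathcomp Require Import all_boot all_order all_algebra.
From mathcomp Require Import complex.
From mathcomp Require Import all_classical all_reals all_analysis.
From mathcomp Require Import measurable_realfun ring lra.

Set Implicit Arguments.
Unset Strict Implicit.
Unset Printing Implicit Defensive.

Import Order.TTheory GRing.Theory Num.Theory.
Import numFieldNormedType.Exports.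
Import Normc.

Local Open Scope ring_scope.
Local Open Scope complex_scope.
Local Open Scope classical_set_scope.

(** * Regular Borel measures *)

(** Three obstacles shape the proof. Multiplication need not be measurable for the product of the
    Borel sigma-algebras of the two factors, so a convolution is taken as an iterated integral in
    one fixed order; its integrand is Borel because for open sets it is lower semicontinuous. Next,
    [convol] and [GL_of] are choices made by [xget], and mean nothing until the object chosen is
    known to exist. For [convol] this amounts to the regularity of the convolution of two positive
    measures, for [GL_of] to the surjectivity of GL(G) -> M(G)^*. Finally, elements of GL(G) are
    families of representatives, so every appeal to [m] must be shown not to depend on the
    representative. That [m] is carried by a compact set comes from the supremum norm: adding to a
    near maximiser of Re m, supported on a compact set, a function of norm at most one supported
    elsewhere does not raise the norm, so [m] must nearly vanish on the added function. Real and
    imaginary parts are bounded separately, which costs factors 2 throughout and changes no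
    conclusion. *)

Lemma open_borel (G : topologicalGroupType) (U : set G) :
  open U -> measurable (U : set (borel G)).
Proof. by move=> oU; apply: sub_gen_smallest. Qed.

Lemma closed_borel (G : topologicalGroupType) (F : set G) :
  closed F -> measurable (F : set (borel G)).
Proof.
by move=> cF; rewrite -(setCK F); apply: measurableC; apply: open_borel; exact: closed_openC.
Qed.

Lemma compact_borel (G : topologicalGroupType) (K : set G) :
  hausdorff_space G -> compact K -> measurable (K : set (borel G)).
Proof. by move=> hG cK; apply: closed_borel; exact: compact_closed. Qed.

Definition mregular (R : realType) (G : topologicalGroupType)
    (m : set (borel G) -> \bar R) :=
  forall (E : set (borel G)) (e : R), measurable E -> 0 < e ->
  exists K U : set G, [/\ compact K, open U, K `<=` E, E `<=` U &
                        (m (U `\` K) < e%:E)%E].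

Section regularity.
Context (R : realType) (G : topologicalGroupType).
Hypothesis G_hausdorff : hausdorff_space G.

Lemma mregular_le_add (m : {finite_measure set (borel G) -> \bar R}) :
  (forall e : R, 0 < e -> exists2 n : {finite_measure set (borel G) -> \bar R},
    mregular n & forall E, measurable E -> (m E <= n E + e%:E)%E) ->
  mregular m.
Proof.
move=> H E e mE e0.
have e2 : 0 < e / 2 by rewrite divr_gt0.
have [n rn mn] := H _ e2.
have [K [U [cK oU KE EU nUK]]] := rn E _ mE e2.
exists K, U; split => //.
have mUK : measurable (U `\` K : set (borel G)).
  by apply: measurableD; [exact: open_borel|exact: compact_borel].
apply: (le_lt_trans (mn _ mUK)).
rewrite [ltRHS](_ : _ = ((e / 2)%:E + (e / 2)%:E)%E); last by rewrite -EFinD -splitr.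
by rewrite lte_leD.
Qed.

(** The sets that can be squeezed between a compact and an open set form a sigma-algebra when [m] is
    finite; the hypothesis puts the open sets into it. *)
Lemma mregular_inner (m : {finite_measure set (borel G) -> \bar R}) :
  (forall U : set G, open U -> exists F : nat -> set G,
     [/\ forall n, compact (F n), forall n, F n `<=` U &
         m (U `\` \bigcup_n F n) = 0%E]) ->
  mregular m.
Proof.
move=> H.
have fin (A B : set (borel G)) : measurable A -> measurable B -> A `<=` B -> (m A <= m B)%E.
  by move=> mA mB AB; rewrite le_measure ?inE.
have mK (K : set G) : compact K -> measurable (K : set (borel G)) by exact: compact_borel.
(* Continuity from above: if countably many compact sets fill [D] up to [e], finitely many do. *)
have contra (D : set (borel G)) (F : nat -> set G) (e : R) : measurable D -> (forall n,
  compact (F n)) -> 0 < e ->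
    (m (D `\` \bigcup_n F n) < e%:E)%E ->
    exists N, (m (D `\` \big[setU/set0]_(n < N) F n) < e%:E)%E.
  move=> mD cF e0 H0.
  pose A n : set (borel G) := D `\` \big[setU/set0]_(k < n) F k.
  have mA n : measurable (A n).
    by apply: measurableD => //; apply: bigsetU_measurable => k _; exact: mK.
  have AE : \bigcap_n A n = D `\` \bigcup_n F n.
    apply/seteqP; split => [x Ax|x [Dx nF] n _].
      split; first by case: (Ax 0%N Logic.I).
      move=> [n _ Fx]; have [_] := Ax n.+1 Logic.I; apply.
      by rewrite big_ord_recr/=; right.
    split => //; rewrite -bigcup_mkord => -[k /= _ Fk]; apply: nF; by exists k.
  have cv : (m \o A) x @[x --> \oo] --> m (D `\` \bigcup_n F n).
    rewrite -AE; apply: nonincreasing_cvg_mu => //.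
    - by rewrite ltey_eq fin_num_measure.
    - by rewrite AE; apply: measurableD => //; apply: bigcupT_measurable => k; exact: mK.
    - move=> i j ij; apply/subsetPset; apply: setDS.
      by apply: subset_bigsetU.
  have [N _ HN] : \forall n \near \oo, ((m \o A) n < e%:E)%E.
    apply: (cv [set x | (x < e%:E)%E]); apply: open_nbhs_nbhs; split => //.
    exact: open_ereal_lt_ereal.
  by exists N; apply: HN => /=.
pose C := [set E : set (borel G) | measurable E /\ forall e : R, 0 < e ->
  exists K U : set G, [/\ compact K, open U, K `<=` E, E `<=` U & (m (U `\` K) < e%:E)%E]].
suff CS : <<s @open G >> `<=` C by move=> E e mE; apply: (CS E mE).2.
have openC U : open U -> C U.
  move=> oU; split; first exact: open_borel.
  move=> e e0; have [F [cF FU mF]] := H _ oU.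
  have [N HN] : exists N, (m (U `\` \big[setU/set0]_(n < N) F n) < e%:E)%E.
    by apply: contra => //; [exact: open_borel|rewrite mF lte_fin].
  exists (\big[setU/set0]_(n < N) F n), U; split => //.
    by apply: bigsetU_compact => k _; exact: cF.
  by rewrite -bigcup_mkord; apply: bigcup_sub => k _; exact: FU.
apply: smallest_sub; last by move=> U; exact: openC.
have halfe (e : R) : e%:E = ((e / 2)%:E + (e / 2)%:E)%E by rewrite -EFinD -splitr.
split.
- exact: openC open0.
- move=> E [mE HE]; rewrite setTD; split; first exact: measurableC.
  move=> e e0.
  have e2 : 0 < e / 2 by rewrite divr_gt0.
  have [K [U [cK oU KE EU mUK]]] := HE _ e2.
  (* The complement of [U] is closed but perhaps not compact; it is intersected with a compact [L]
     of nearly full measure. *)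
  have [L [V [cL oV _ TV mL]]] := (openC _ openT).2 _ e2.
  have mLT : (m (~` L) < (e / 2)%:E)%E.
    apply: le_lt_trans mL; apply: fin; [by apply: measurableC; exact: mK| |].
      by apply: measurableD; [exact: open_borel|exact: mK].
    by move=> x nL; split => //; exact: TV.
  exists (~` U `&` L), (~` K); split.
  + rewrite setIC; apply: compact_closedI => //; exact: open_closedC.
  + by apply: closed_openC; exact: compact_closed.
  + by move=> x [nU _] /EU.
  + by move=> x nE /KE.
  + have mU := open_borel oU; have mKK := mK _ cK; have mLL := mK _ cL.
    rewrite halfe; apply: (le_lt_trans _ (lteD mUK mLT)).
    apply: (@le_trans _ _ (m ((U `\` K) `|` ~` L))); last first.
      by apply: measureU2; [exact: measurableD|exact: measurableC].
    apply: fin.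
      apply: measurableD; first exact: measurableC.
      by apply: measurableI => //; exact: measurableC.
      by apply: measurableU; [exact: measurableD|exact: measurableC].
    move=> x [nK nUL]; have [Ux|nUx] := pselect (U x); first by left.
    by right => Lx; apply: nUL.
- move=> A HA; split; first by apply: bigcupT_measurable => k; exact: (HA k).1.
  move=> e e0.
  (* Summing gives only a weak inequality; starting below [e] makes the final one strict. *)
  have e4 : 0 < e / 4 by rewrite divr_gt0.
  have epos k : 0 < e / 4 / (2 ^ k.+1)%:R by rewrite divr_gt0 // ltr0n expn_gt0.
  have /choice[K HK] k : exists K : set G, exists U : set G,
      [/\ compact K, open U, K `<=` A k,
        A k `<=` U & (m (U `\` K) < (e / 4 / (2 ^ k.+1)%:R)%:E)%E].
    exact: (HA k).2.
  have /choice[U HU] := HK.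
  have mUU : measurable (\bigcup_k U k : set (borel G)).
    by apply: bigcupT_measurable => k; apply: open_borel; case: (HU k).
  have mUK k : measurable (U k `\` K k : set (borel G)).
    by case: (HU k) => cK oU _ _ _; apply: measurableD; [exact: open_borel|exact: mK].
  have mKK : measurable (\bigcup_k K k : set (borel G)).
    by apply: bigcupT_measurable => k; apply: mK; case: (HU k).
  have : (m (\bigcup_k U k `\` \bigcup_k K k) < e%:E)%E.
    apply: (@le_lt_trans _ _ (m (\bigcup_k (U k `\` K k)))).
      apply: fin; [exact: measurableD|by apply: bigcupT_measurable|].
      by move=> x [[k _ Uk] nK]; exists k => //; split => // Kk; apply: nK; exists k.
    apply: (@le_lt_trans _ _ (\sum_(0 <= k <oo) m (U k `\` K k))%E).
      by apply: measure_sigma_subadditive => //; apply: bigcupT_measurable.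
    apply: (@le_lt_trans _ _ (e / 4)%:E).
      apply: le_trans (epsilon_trick0 xpredT (ltW e4)).
      apply: lee_nneseries => [k _ _|k _]; first exact: measure_ge0.
      by apply: ltW; case: (HU k).
    by rewrite lte_fin; lra.
  move=> /(contra _ _ _ mUU) [|//|N HN]; first by move=> n; case: (HU n).
  exists (\big[setU/set0]_(n < N) K n), (\bigcup_k U k); split => //.
  + by apply: bigsetU_compact => k _; case: (HU k).
  + by apply: bigcup_open => k _; case: (HU k).
  + rewrite -bigcup_mkord => x [k _ Kx]; exists k => //; have [_ _ KA _ _] := HU k; exact: KA.
  + by apply: subset_bigcup => k _; case: (HU k).
Qed.

End regularity.

Record rmeas (R : realType) (G : topologicalGroupType) := RMeas {
  rm :> {finite_measure set (borel G) -> \bar R} ;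
  rm_regular : mregular rm }.
Section rmeas_theory.
Context (R : realType) (G : topologicalGroupType).
Implicit Types (a b : rmeas R G).

Lemma rm_fin a E : measurable E -> a E \is a fin_num.
Proof. by move=> mE; rewrite fin_num_measure. Qed.

Lemma rm_ge0 a E : (0 <= a E)%E.
Proof. exact: measure_ge0. Qed.

Lemma rm_le a E F : measurable E -> measurable F -> E `<=` F -> (a E <= a F)%E.
Proof. by move=> mE mF EF; apply: le_measure; rewrite ?inE. Qed.

Lemma rm_setD a E F : measurable E -> measurable F -> F `<=` E ->
  a (E `\` F) = (a E - a F)%E.
Proof.
by move=> mE mF FE; rewrite measureD ?(setIidr FE)// ltey_eq rm_fin.
Qed.

End rmeas_theory.

(** * Convolution of positive measures *)

Section translates.
Context (R : realType) (G : topologicalGroupType).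
Hypothesis G_hausdorff : hausdorff_space G.
Implicit Types (a b : rmeas R G).

Definition ltrans (x : G) (E : set (borel G)) : set (borel G) :=
  [set y : G | E (x * y)%g].

Lemma ltrans_continuous (x : G) : continuous (fun y : G => (x * y)%g).
Proof.
move=> y; apply: (@continuous_comp _ _ _ (fun y : G => (x, y)) (fun z : G * G =>
  (z.1 * z.2)%g)).
  by apply: cvg_pair => //; exact: cvg_cst.
exact: mulg_continuous.
Qed.

Lemma measurable_ltrans x E : measurable E -> measurable (ltrans x E).
Proof.
move=> mE.
have mf : measurable_fun setT ((fun y : G => (x * y)%g) : borel G -> borel G).
  apply: (@measurability _ _ (borel G) (borel G) setT _ (@open G) erefl) => _ [U oU <-].
  rewrite setTI; apply: open_borel; move/continuousP : (@ltrans_continuous x); exact.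
by rewrite -[ltrans x E]setTI; apply: mf.
Qed.

Lemma rm_inner a (E : set (borel G)) (t : \bar R) : measurable E -> (t < a E)%E ->
  exists K : set G, [/\ compact K, K `<=` E & (t < a K)%E].
Proof.
move=> mE tE.
have finE : a E \is a fin_num by rewrite fin_num_measure.
have [t0|t0] := ltP t 0%E.
  by exists set0; split; [exact: compact0|by []|rewrite measure0].
have fint : t \is a fin_num by rewrite fin_numElt (lt_le_trans _ t0)//= (lt_trans tE)//
  ltey_eq finE.
have e0 : 0 < fine (a E) - fine t by rewrite subr_gt0 -lte_fin !fineK.
have [K [U [cK oU KE EU aUK]]] := @rm_regular _ _ a E _ mE e0.
exists K; split => //.
have mK := compact_borel G_hausdorff cK.
have : (a (E `\` K) < (fine (a E) - fine t)%:E)%E.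
  apply: le_lt_trans aUK; apply: le_measure; rewrite ?inE.
  - exact: measurableD.
  - by apply: measurableD => //; exact: open_borel.
  - exact: setSD.
have finK : a K \is a fin_num by rewrite fin_num_measure.
have -> : a (E `\` K) = (a E - a K)%E.
  exact: rm_setD.
move: finE finK fint; case: (a E) => // r _; case: (a K) => // s _; case: (t) => // u _ /=.
by rewrite !lte_fin ltrD2l ltrN2.
Qed.

(** Tube lemma: multiplication sends a neighbourhood of each (x, c) with [c] in [C] into [U], and
    compactness of [C] makes the neighbourhood of [x] uniform in [c]. *)
Lemma near_ltrans_sub (x : G) (C U : set G) : compact C -> open U ->
  C `<=` ltrans x U -> \forall y \near x, C `<=` ltrans y U.
Proof.
move=> /compact_near_coveringP cC oU CU; apply: cC => c Cc.
have : \forall z \near (x, c), U (z.1 * z.2)%g.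
  by apply: mulg_continuous; apply: open_nbhs_nbhs; split => //; exact: CU.
case=> -[A B] /= [xA cB] AB.
exists (B, A) => //= -[c' y] [/= Bc' Ay].
exact: (AB (y, c')).
Qed.

(** Lower semicontinuity: a compact subset of x^-1 U of measure above [t] still lies in y^-1 U for
    [y] near [x]. *)
Lemma open_ltrans_gt b (U : set G) (t : \bar R) : open U ->
  open [set x : G | (t < b (ltrans x U))%E].
Proof.
move=> oU.
have nbhs_open (S : set G) : (forall x, S x -> \forall y \near x, S y) -> open S.
  by move=> H; rewrite openE.
apply: nbhs_open => x /= tx.
have mU y : measurable (ltrans y U) by apply: measurable_ltrans; exact: open_borel.
have [C [cC CU tC]] := rm_inner (mU x) tx.
apply: filterS (near_ltrans_sub cC oU CU) => y Cy /=.
apply: (lt_le_trans tC); apply: le_measure; rewrite ?inE//.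
exact: compact_borel.
Qed.

Lemma trivIset_ltrans (F : nat -> set (borel G)) (x : G) :
  trivIset setT F -> trivIset setT (fun n => ltrans x (F n)).
Proof.
move=> /trivIsetP tF; apply/trivIsetP => i j _ _ /(tF i j Logic.I Logic.I) Fij.
apply/seteqP; split => [y [Fi Fj]|y []//].
by have : (F i `&` F j) (x * y)%g by []; rewrite Fij.
Qed.

(** Open sets form a pi-system generating the Borel sets, and semicontinuity settles them;
    complements use that [b] is finite. This stands in for joint measurability of multiplication. *)
Lemma measurable_fun_ltrans b E : measurable E ->
  measurable_fun setT (fun x : borel G => b (ltrans x E)).
Proof.
move: E; apply: (@dynkin_induction _ (borel G) (@open G)) => //.
- by move=> A B oA oB; exact: openI.
- have -> : (fun x : borel G => b (ltrans x setT)) = cst (b setT) by [].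
  exact: measurable_cst.
- move=> U oU; apply: (measurability _ (ErealGenOInfty.measurableE R)).
  move=> /= _ [_ [t ->]] <-; rewrite setTI; apply: open_borel.
  by rewrite preimage_itvoy; exact: open_ltrans_gt.
- move=> E mE mfE.
  rewrite (_ : (fun _ => _) = (fun x : borel G => b setT - b (ltrans x E))%E).
    by apply: emeasurable_funB => //; exact: measurable_cst.
  apply/funext => x.
  have -> : ltrans x (~` E) = setT `\` ltrans x E by rewrite setTD.
  rewrite measureD ?setTI//; first exact: measurable_ltrans.
  by rewrite ltey_eq fin_num_measure.
- move=> F mF tF mfF.
  rewrite (_ : (fun _ => _) = (fun x : borel G => \sum_(k <oo) b (ltrans x (F k))))%E.
    by apply: ge0_emeasurable_sum.
  apply/funext => x.
  have -> : ltrans x (\bigcup_k F k) = \bigcup_k ltrans x (F k) by [].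
  rewrite measure_semi_bigcup//.
  - by move=> k; exact: measurable_ltrans.
  - exact: trivIset_ltrans.
  - by apply: bigcupT_measurable => k; exact: measurable_ltrans.
Qed.

End translates.

Section positive_convolution.
Context (R : realType) (G : topologicalGroupType).

(* The Hausdorff hypothesis is a phantom argument: it is what makes the measure
   structure of pconv inferable. *)
Definition pconv (a b : rmeas R G) & hausdorff_space G :=
  fun E : set (borel G) => (\int[a]_x b (ltrans x E))%E.

Context (a b : rmeas R G) (G_hausdorff : hausdorff_space G).
Local Notation ab := (pconv a b G_hausdorff).

Let pconv0 : ab set0 = 0%E.
Proof. by apply: integral0_eq => x _; rewrite measure0. Qed.

Let pconv_ge0 E : (0 <= ab E)%E.
Proof. by apply: integral_ge0 => x _; exact: measure_ge0. Qed.

Let pconv_sigma_additive : semi_sigma_additive ab.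
Proof.
move=> F mF tF mUF.
rewrite [X in _ --> X](_ : _ = (\sum_(n <oo) ab (F n))%E).
  by apply: is_cvg_ereal_nneg_natsum => n _; exact: pconv_ge0.
rewrite /pconv -integral_nneseries//.
- apply: eq_integral => x _.
  rewrite -[RHS]measure_semi_bigcup//.
  + by move=> k; exact: measurable_ltrans.
  + exact: trivIset_ltrans.
  + by apply: bigcupT_measurable => k; exact: measurable_ltrans.
- by move=> n; exact: measurable_fun_ltrans.
Qed.

HB.instance Definition _ := isMeasure.Build _ _ _ ab
  pconv0 pconv_ge0 pconv_sigma_additive.

Lemma pconvT : ab setT = (a setT * b setT)%E.
Proof.
rewrite /pconv (_ : (fun _ => _) = cst (b setT))//.
by rewrite integral_cst// muleC.
Qed.

Let pconv_finite : fin_num_fun ab.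
Proof.
suff: (ab [set: borel G] < +oo)%E by exact: lty_fin_num_fun.
rewrite pconvT.
by rewrite ltey_eq fin_numM// fin_num_measure.
Qed.

HB.instance Definition _ := @Measure_isFinite.Build _ _ _ ab pconv_finite.

End positive_convolution.

Section pconv_regular.
Context (R : realType) (G : topologicalGroupType).
Hypothesis G_hausdorff : hausdorff_space G.
Hypothesis G_locally_compact : locally_compact [set: G].
Implicit Types (a b : rmeas R G).

Lemma nbhs_compact (x : G) (N : set G) : nbhs x N ->
  exists W : set G, [/\ nbhs x W, compact W & W `<=` N].
Proof.
move=> xN.
have [V] := G_locally_compact (Logic.I : [set: G] x).
rewrite withinET => xV [cV clV].
have [B xB BN] := @compact_regular G x V G_hausdorff cV xV N xN.
exists (closure B `&` V); split.
- apply: filterI => //; apply: filterS xB; exact: subset_closure.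
- rewrite setIC; apply: compact_closedI => //; exact: closed_closure.
- by move=> y [/BN].
Qed.

Lemma compact_mulg (A B : set G) : compact A -> compact B ->
  compact [set z | exists x y, [/\ A x, B y & z = (x * y)%g]].
Proof.
move=> cA cB.
have := @continuous_compact _ _ (fun z : G * G => (z.1 * z.2)%g) (A `*` B)
  (continuous_subspaceT (@mulg_continuous G)) (compact_setX cA cB).
rewrite (_ : _ @` _ = [set z | exists x y, [/\ A x, B y & z = (x * y)%g]])//.
apply/seteqP; split => [z [[x y] [Ax By] <-]|z [x [y [Ax By ->]]]].
  by exists x, y.
by exists (x, y).
Qed.

Lemma compact_level_inner b (U L : set G) (t : \bar R) : open U -> compact L ->
  L `<=` [set x : G | (t < b (ltrans x U))%E] ->
  exists K, [/\ compact K, K `<=` U &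
    L `<=` [set x : G | (t < b (ltrans x K))%E]].
Proof.
move=> oU /compact_near_coveringP cL LU.
pose D := [set K : set G | compact K /\ K `<=` U].
pose B (K : set G) := [set K' : set G | D K' /\ K `<=` K'].
(* L is covered by the sets {x | t < b (x^-1 K)}, K ranging over the upward
   directed family of compact subsets of U. *)
have FF : Filter (filter_from D B).
  apply: filter_from_filter; first by exists set0; split => //; exact: compact0.
  move=> K1 K2 [cK1 K1U] [cK2 K2U]; exists (K1 `|` K2).
    by split; [exact: compactU|rewrite subUset].
  by move=> K' [DK']; rewrite subUset => -[? ?].
have : \forall K' \near filter_from D B, L `<=` [set x : G | (t < b (ltrans x K'))%E].
  apply: cL => x Lx.
  have mU : measurable (ltrans x U) by apply: measurable_ltrans; exact: open_borel.
  have [C [cC CU tC]] := rm_inner G_hausdorff mU (LU _ Lx).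
  have [W [xW cW WC]] := nbhs_compact (near_ltrans_sub cC oU CU).
  (* The product W C is compact, lies in [U], and its translates y^-1 W C with [y] in [W] all
     contain [C]. *)
  exists (W, B [set z | exists x y, [/\ W x, C y & z = (x * y)%g]]) => /=.
    split => //; exists [set z | exists x y, [/\ W x, C y & z = (x * y)%g]] => //.
    split; first exact: compact_mulg.
    by move=> _ [y [c [Wy Cc ->]]]; exact: (WC _ Wy).
  move=> [y K'] /= [Wy [[cK' K'U] WCK']].
  apply: (lt_le_trans tC); apply: le_measure; rewrite ?inE.
  - exact: compact_borel.
  - by apply: measurable_ltrans; exact: compact_borel.
  - by move=> c Cc; apply: WCK'; exists y, c.
case=> K [cK KU] BK; exists K; split => //.
by apply: BK; split.
Qed.

(* For rational q, the level {x | q < b (x^-1 U)} is open; exhausting it by compact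
   sets gives countably many compact subsets of U whose union H satisfies
   b (x^-1 H) = b (x^-1 U) for almost every x. *)
Lemma pconv_regular a b : mregular (pconv a b G_hausdorff).
Proof.
apply: mregular_inner => // U oU.
pose O (q : rat) := [set x : G | ((ratr q)%:E < b (ltrans x U))%E].
have mb E : measurable E -> measurable_fun [set: borel G] (fun x : borel G => b (ltrans x E)).
  exact: measurable_fun_ltrans.
have mUb : measurable (U : set (borel G)) by exact: open_borel.
have oO q : open (O q) by exact: open_ltrans_gt.
(* A compact [L] fills the level set [O q] up to 1/(n+1), and a single compact subset of [U] keeps
   the measure of its translates above [q] on all of [L]. *)
have /choice[F HF] (qn : rat * nat) : exists K : set G, [/\ compact K, K `<=` U &
    (a (O qn.1 `\` [set x : G | ((ratr qn.1)%:E < b (ltrans x K))%E]) < (qn.2.+1%:R^-1)%:E)%E].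
  case: qn => q n /=.
  have [L [V [cL oV LO OV aVL]]] :=
    @rm_regular _ _ a (O q) (n.+1%:R^-1) (open_borel (oO q)) (ltac:(by rewrite invr_gt0)).
  have [K [cK KU LK]] := compact_level_inner oU cL LO.
  exists K; split => //; apply: le_lt_trans aVL.
  have mK := compact_borel G_hausdorff cK.
  apply: le_measure; rewrite ?inE.
  - apply: measurableD; first exact: open_borel.
    by rewrite -[X in measurable X]setTI; apply: emeasurable_fun_o_infty => //; exact: mb.
  - by apply: measurableD; [exact: open_borel|exact: compact_borel].
  - by move=> x [/OV Vx nK]; split => // /LK.
have cF qn : compact (F qn) by case: (HF qn).
have mF qn : measurable (F qn : set (borel G)) by exact: compact_borel.
pose H n := if unpickle n is Some qn then F qn else set0.
exists H; split.
- by move=> n; rewrite /H; case: unpickle => [qn|]; [exact: cF|exact: compact0].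
- by move=> n; rewrite /H; case: unpickle => [qn|//]; case: (HF qn).
have mH : measurable (\bigcup_n H n : set (borel G)).
  by apply: bigcupT_measurable => n; rewrite /H; case: unpickle => [qn|//]; exact: mF.
have FH qn : F qn `<=` \bigcup_n H n.
  by move=> x Fx; exists (pickle qn); [exact: Logic.I|rewrite /H pickleK].
(* Points where [U] exceeds the level [q] and the countable union does not. This set is null,
   because [F (q, n)] leaves out less than 1/(n+1) for every [n]. *)
pose A q : set (borel G) :=
  O q `\` [set x : G | ((ratr q)%:E < b (ltrans x (\bigcup_n H n)))%E].
have mA q : measurable (A q).
  apply: measurableD; first exact: open_borel.
  by rewrite -[X in measurable X]setTI; apply: emeasurable_fun_o_infty => //; exact: mb.
have a0 q : a (A q) = 0%E.
  apply/eqP; rewrite eq_le measure_ge0 andbT.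
  apply/lee_addgt0Pr => e e0; rewrite add0e.
  have [n _ Hn] := near_infty_natSinv_lt (PosNum e0).
  apply/ltW/(lt_trans _ (y := (n.+1%:R^-1)%:E)); last by rewrite lte_fin; apply: Hn => /=.
  have [_ _ /=] := HF (q, n); apply: le_lt_trans.
  apply: le_measure; rewrite ?inE//.
  - apply: measurableD; first exact: open_borel.
    by rewrite -[X in measurable X]setTI; apply: emeasurable_fun_o_infty => //; exact: mb.
  - apply: setDS => x /= /lt_le_trans; apply; apply: le_measure; rewrite ?inE.
    + exact: measurable_ltrans.
    + exact: measurable_ltrans.
    + by move=> y; exact: FH.
have mUH : measurable (U `\` \bigcup_n H n : set (borel G)) by exact: measurableD.
rewrite -[LHS]/(\int[a]_x b (ltrans x (U `\` \bigcup_n H n)))%E.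
transitivity (\int[a]_x (cst 0%E x : \bar R))%E; last by rewrite integral0.
apply: ae_eq_integral => //; first exact: mb.
have : a.-negligible (\bigcup_n (if unpickle n is Some q then A q else set0)).
  apply: negligible_bigcup => n; case: unpickle => [q|]; last exact: negligible_set0.
  by exists (A q); split; [exact: mA|exact: a0|].
apply: negligibleS => x /= /not_implyP[_ bx0].
have mxU : measurable (ltrans x U) by exact: measurable_ltrans.
have mxH : measurable (ltrans x (\bigcup_n H n)) by exact: measurable_ltrans.
have lt : (b (ltrans x (\bigcup_n H n)) < b (ltrans x U))%E.
  rewrite lt_neqAle; apply/andP; split; last first.
    apply: le_measure; rewrite ?inE// => y [n _].
    by rewrite /H; case: unpickle => [qn|//]; case: (HF qn) => _ + _; apply.
  apply/eqP => e; apply: bx0.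
  have -> : ltrans x (U `\` \bigcup_n H n) = ltrans x U `\` ltrans x (\bigcup_n H n) by [].
  rewrite rm_setD//; last first.
    move=> y [n _]; rewrite /H; case: unpickle => [qn|//]; case: (HF qn) => _ + _; apply.
  by rewrite e subee// fin_num_measure.
have finH : b (ltrans x (\bigcup_n H n)) \is a fin_num by rewrite fin_num_measure.
have finU : b (ltrans x U) \is a fin_num by rewrite fin_num_measure.
(* Where the two values differ, a rational separates them, and the point falls into some [A q]. *)
have /rat_in_itvoo[q] : fine (b (ltrans x (\bigcup_n H n))) < fine (b (ltrans x U)).
  by rewrite -lte_fin !fineK.
rewrite in_itv/= => /andP[q1 q2].
exists (pickle q); first exact: Logic.I.
rewrite pickleK; split.
  by rewrite /O/= -(fineK finU) lte_fin.
move=> qx; have : ((ratr q)%:E < b (ltrans x (\bigcup_n H n)))%E := qx.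
by rewrite -(fineK finH) lte_fin => /(lt_trans q1); rewrite ltxx.
Qed.

Definition rconv a b : rmeas R G := RMeas (@pconv_regular a b).

End pconv_regular.

(** * Functionals on positive measures and their densities *)

Section rmeas_operations.
Context (R : realType) (G : topologicalGroupType).
Hypothesis G_hausdorff : hausdorff_space G.
Implicit Types (a b c : rmeas R G).

Lemma mregular_le (m : {finite_measure set (borel G) -> \bar R}) a :
  (forall E, measurable E -> (m E <= a E)%E) -> mregular m.
Proof.
move=> ma; apply: mregular_le_add => // e e0; exists a; first exact: rm_regular.
move=> E mE; apply: (le_trans (ma _ mE)).
by rewrite leeDl// lee_fin ltW.
Qed.

Definition rrestr_fun a (D : set (borel G)) (mD : measurable D) : {finite_measure set (borel
  G) -> \bar R} :=
  mrestr a mD.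

Lemma rrestr_regular a D (mD : measurable D) : mregular (rrestr_fun a mD).
Proof.
apply: (@mregular_le _ a) => E mE.
by apply: rm_le => //; exact: measurableI.
Qed.

Definition rrestr a (D : set (borel G)) (mD : measurable D) : rmeas R G :=
  RMeas (rrestr_regular a mD).

Lemma rrestrE a (D : set (borel G)) (mD : measurable D) E :
  rrestr a mD E = a (E `&` D).
Proof. by []. Qed.

Lemma rrestr_le a (D : set (borel G)) (mD : measurable D) E :
  measurable E -> (rrestr a mD E <= a E)%E.
Proof. by move=> mE; rewrite rrestrE; apply: rm_le => //; exact: measurableI. Qed.

Definition rlin_fun (t : {nonneg R}) a b := measure_add (mscale t a) b.

Lemma rlin_funE t a b E : rlin_fun t a b E = (t%:num%:E * a E + b E)%E.
Proof. exact: measure_addE. Qed.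

Lemma rlin_fin t a b : fin_num_fun (rlin_fun t a b).
Proof.
by move=> E mE; rewrite rlin_funE fin_numD fin_numM// rm_fin.
Qed.

HB.instance Definition _ t a b := Measure.on (rlin_fun t a b).
HB.instance Definition _ t a b :=
  @Measure_isFinite.Build _ _ _ (rlin_fun t a b) (@rlin_fin t a b).

Lemma rlin_regular t a b : mregular (rlin_fun t a b).
Proof.
move=> E e mE e0.
have t1 : 0 < t%:num + 1 :> R by rewrite ltr_wpDl.
(* The added 1 allows [t] to be 0. *)
have e2 : 0 < e / (2 * (t%:num + 1)) by rewrite divr_gt0// mulr_gt0.
have e3 : 0 < e / 2 by rewrite divr_gt0.
have [K [U [cK oU KE EU aUK]]] := @rm_regular _ _ a E _ mE e2.
have [L [V [cL oV LE EV bVL]]] := @rm_regular _ _ b E _ mE e3.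
have [mK mL] := (compact_borel G_hausdorff cK, compact_borel G_hausdorff cL).
have [mU mV] := (open_borel oU, open_borel oV).
exists (K `|` L), (U `&` V); split.
- exact: compactU.
- exact: openI.
- by rewrite subUset.
- by rewrite subsetI.
have mUV : measurable ((U `&` V) `\` (K `|` L) : set (borel G)).
  by apply: measurableD; [exact: measurableI|exact: measurableU].
rewrite [X in (X < _)%E](_ : _ = (t%:num%:E * a ((U `&` V) `\` (K `|` L)) + b ((U `&` V) `\`
  (K `|` L)))%E); last exact: rlin_funE.
have aS : (a ((U `&` V) `\` (K `|` L)) <= a (U `\` K))%E.
  apply: rm_le => //; first exact: measurableD.
  by move=> x [[Ux _] nKL]; split => // Kx; apply: nKL; left.
have bS : (b ((U `&` V) `\` (K `|` L)) <= b (V `\` L))%E.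
  apply: rm_le => //; first exact: measurableD.
  by move=> x [[_ Vx] nKL]; split => // Lx; apply: nKL; right.
have := le_lt_trans aS aUK; have := le_lt_trans bS bVL.
rewrite -(fineK (rm_fin a mUV)) -(fineK (rm_fin b mUV)) -EFinM -EFinD !lte_fin.
move=> bl al.
have a0 : 0 <= fine (a ((U `&` V) `\` (K `|` L))) by rewrite fine_ge0// rm_ge0.
have : t%:num * fine (a ((U `&` V) `\` (K `|` L))) <= e / 2; last by move=> ?; lra.
apply: (@le_trans _ _ ((t%:num + 1) * (e / (2 * (t%:num + 1))))).
  by apply: ler_pM => //; [rewrite lerDl|exact: ltW].
by rewrite le_eqVlt; apply/orP; left; apply/eqP; field; rewrite gt_eqF.
Qed.

Definition rlin t a b : rmeas R G := RMeas (@rlin_regular t a b).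

Lemma rlinE t a b E : rlin t a b E = (t%:num%:E * a E + b E)%E.
Proof. exact: rlin_funE. Qed.

Lemma regular_mzero : mregular (mzero : {finite_measure set (borel G) -> \bar R}).
Proof.
move=> E e mE e0; exists set0, setT; split; [exact: compact0|exact: openT|by []|by []|].
by rewrite [X in (X < _)%E](_ : _ = 0%E)// lte_fin.
Qed.

Definition rzero : rmeas R G := RMeas regular_mzero.

(** The difference b - a is a positive measure below [b], hence regular. It yields the monotonicity
    of positive additive functionals. *)
Lemma rm_sub a b : (forall E, measurable E -> (a E <= b E)%E) ->
  exists c, forall E, measurable E -> b E = (a E + c E)%E.
Proof.
move=> ab.
pose nu : {charge set (borel G) -> \bar R} :=
  cadd (charge_of_finite_measure b) (copp (charge_of_finite_measure a)).
(* [crestr0] puts the value 0 on non-Borel sets, where a charge is arbitrary while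
   [measure_of_charge] asks for positivity on every set. *)
pose nu0 : {charge set (borel G) -> \bar R} := crestr0 nu measurableT.
have nuE E : measurable E -> nu0 E = (b E - a E)%E.
  by move=> mE; rewrite /nu0 /= /crestr0 mem_set// /crestr setIT.
have nu0_ge0 E : (0 <= nu0 E)%E.
  have [mE|nmE] := pselect (measurable E).
    by rewrite nuE// sube_ge0 ?ab// rm_fin.
  by rewrite /nu0 /= /crestr0 memNset.
pose m := measure_of_charge nu0 nu0_ge0.
have finm : fin_num_fun m by move=> E mE; rewrite /m; exact: fin_num_measure.
pose M : {finite_measure set (borel G) -> \bar R} :=
  HB.pack m (@Measure_isFinite.Build _ _ _ m finm).
have ME E : measurable E -> M E = (b E - a E)%E by exact: nuE.
have MR : mregular M.
  apply: (@mregular_le _ b) => E mE; rewrite ME//.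
  by rewrite leeBlDr ?rm_fin// leeDl// rm_ge0.
exists (RMeas MR) => E mE; rewrite [X in (_ + X)%E](_ : _ = (b E - a E)%E); last exact: ME.
by rewrite addeC subeK// rm_fin.
Qed.

End rmeas_operations.

Section functionals.
Context (R : realType) (G : topologicalGroupType).
Hypothesis G_hausdorff : hausdorff_space G.
Implicit Types (a b c : rmeas R G) (phi : rmeas R G -> R).

Definition mass a : R := fine (a setT).

Lemma massE a : (mass a)%:E = a setT.
Proof. by rewrite fineK// rm_fin. Qed.

Lemma mass_ge0 a : 0 <= mass a.
Proof. by rewrite fine_ge0// rm_ge0. Qed.

(** [c] ranges over all measures that agree with ta + b on Borel sets, not over one construction of
    the sum; invariance under equality on Borel sets is then the case [t = 0]. *)
Definition rm_linear phi := forall (t : R) a b c, 0 <= t ->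
  (forall E, measurable E -> c E = (t%:E * a E + b E)%E) ->
  phi c = t * phi a + phi b.

Lemma mass_linear : rm_linear mass.
Proof.
move=> t a b c t0 H.
by apply: EFin_inj; rewrite EFinD EFinM !massE H.
Qed.

Context phi (phi_lin : rm_linear phi).

Lemma rm_linear_ext a b : (forall E, measurable E -> a E = b E) -> phi a = phi b.
Proof.
move=> ab; rewrite (@phi_lin 0 a b a)// ?mul0r ?add0r// => E mE.
by rewrite mul0e add0e ab.
Qed.

Lemma rm_linearD a b c : (forall E, measurable E -> c E = (a E + b E)%E) ->
  phi c = phi a + phi b.
Proof.
by move=> H; rewrite (@phi_lin 1 a b c) ?mul1r// => E mE; rewrite mul1e H.
Qed.

Lemma rm_linear0 a : (forall E, measurable E -> a E = 0%E) -> phi a = 0.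
Proof.
move=> a0; have H : phi a = phi a + phi a.
  by apply: rm_linearD => E mE; rewrite a0// add0e.
by lra.
Qed.

Lemma rm_linear_le (phi_ge0 : forall a, 0 <= phi a) a b :
  (forall E, measurable E -> (a E <= b E)%E) -> phi a <= phi b.
Proof.
move=> /(rm_sub G_hausdorff)[c /rm_linearD ->].
by rewrite lerDl.
Qed.

End functionals.

(** On the set where [f > C], the positive function [f - C] has integral at most 0, so this set is
    null. *)
Lemma integral_le_measure0 d (T : measurableType d) (R : realType)
    (mu : {finite_measure set T -> \bar R}) (D : set T) (f : T -> \bar R) (C : R) :
  measurable D -> mu.-integrable D f ->
  (forall E, measurable E -> E `<=` D -> (\int[mu]_(x in E) f x <= C%:E * mu E)%E) ->
  mu (D `&` [set x | (C%:E < f x)%E]) = 0%E.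
Proof.
move=> mD fint fle; set A := _ `&` _.
have mf := measurable_int _ fint.
have mA : measurable A by exact: emeasurable_fun_o_infty.
have AD : A `<=` D by move=> x [].
have fintA : mu.-integrable A f by exact: integrableS fint.
have CintA : mu.-integrable A (EFin \o cst C) by exact: finite_measure_integrable_cst.
have fA : (\int[mu]_(x in A) f x)%E \is a fin_num by exact: integrable_fin_num.
have CA : (C%:E * mu A)%E \is a fin_num by rewrite fin_numM// fin_num_measure.
have A0 : (\int[mu]_(x in A) (f x - C%:E) = 0)%E.
  apply/eqP; rewrite eq_le; apply/andP; split; last first.
    by apply: integral_ge0 => x [_ /ltW]; rewrite sube_ge0.
  rewrite (integralB mA fintA CintA)/= integral_cst//.
  by rewrite leeBlDr// add0e fle.
have : (\int[mu]_(x in A) `|f x - C%:E| = 0)%E.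
  rewrite -[RHS]A0; apply: eq_integral => x; rewrite inE => -[_ /= /ltW].
  by rewrite -sube_ge0// => /gee0_abs.
move/ae_eq_integral_abs => /(_ mA).
have mfA : measurable_fun A (fun x => f x - C%:E)%E.
  by apply: emeasurable_funB; [exact: measurable_int fintA|exact: measurable_cst].
move=> /(_ mfA)[N [mN N0 AN]].
apply/eqP; rewrite eq_le measure_ge0 andbT -N0.
apply: le_measure; rewrite ?inE// => x Ax; apply: AN => /=; apply/not_implyP; split=> //.
by case: Ax => _ /=; rewrite -sube_gt0// => /gt_eqF/eqP.
Qed.

(** * The density of a positive functional at one base measure *)

Section positive_functional.
Context (R : realType) (G : topologicalGroupType).
Hypothesis G_hausdorff : hausdorff_space G.
Implicit Types (a b c : rmeas R G).
Context (psi : rmeas R G -> R) (C : R).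
Hypothesis psi_lin : rm_linear psi.
Hypothesis psi_ge0 : forall a, 0 <= psi a.
Hypothesis psi_le : forall a, psi a <= C * mass a.

(* The hypotheses on psi are phantom arguments, from which the measure structure
   is inferred. *)
Definition psi_measure (_ : rm_linear psi) (_ : forall a, 0 <= psi a)
    (_ : forall a, psi a <= C * mass a) a (E : set (borel G)) : \bar R :=
  if pselect (measurable E) is left mE then (psi (rrestr G_hausdorff a mE))%:E
  else 0%E.

Local Notation psi_meas := (psi_measure psi_lin psi_ge0 psi_le).

Lemma psi_measE a E (mE : measurable E) :
  psi_meas a E = (psi (rrestr G_hausdorff a mE))%:E.
Proof.
rewrite /psi_measure; case: pselect => // mE'.
by rewrite (Prop_irrelevance mE' mE).
Qed.

Lemma psi_meas_ge0 a E : (0 <= psi_meas a E)%E.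
Proof. by rewrite /psi_measure; case: pselect => // mE; rewrite lee_fin. Qed.

Lemma psi_meas_le a E : measurable E -> (psi_meas a E <= C%:E * a E)%E.
Proof.
move=> mE; rewrite (psi_measE a mE).
apply: (@le_trans _ _ (C * mass (rrestr G_hausdorff a mE))%:E).
  by rewrite lee_fin.
by rewrite EFinM massE rrestrE setTI.
Qed.

Lemma psi_meas0 a : psi_meas a set0 = 0%E.
Proof.
rewrite (psi_measE a measurable0); congr EFin.
by apply: rm_linear0 => // E mE; rewrite rrestrE setI0 measure0.
Qed.

Lemma psi_measU a E F : measurable E -> measurable F -> [disjoint E & F] ->
  psi_meas a (E `|` F) = (psi_meas a E + psi_meas a F)%E.
Proof.
move=> mE mF /disj_setPS EF0; have mEF := measurableU _ _ mE mF.
rewrite (psi_measE a mE) (psi_measE a mF) (psi_measE a mEF) -EFinD; congr EFin.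
apply: rm_linearD => // D mD.
rewrite [LHS]rrestrE setIUr measureU//; [exact: measurableI|exact: measurableI|].
by rewrite setIACA setIid; apply/seteqP; split => // x [_ /EF0].
Qed.

Lemma psi_meas_fin a : fin_num_fun (psi_meas a).
Proof. by move=> E mE; rewrite (psi_measE a mE). Qed.

(** Finite additivity plus the bound by [C * mass]: the tails of the union have [a]-measure tending
    to 0, and the bound carries this over to [psi]. *)
Lemma psi_meas_sigma_additive a : semi_sigma_additive (psi_meas a).
Proof.
move=> F mF tF mUF.
pose T n := (\bigcup_k F k) `\` \big[setU/set0]_(k < n) F k.
have mB n : measurable (\big[setU/set0]_(k < n) F k).
  by apply: bigsetU_measurable.
have mT n : measurable (T n) by exact: measurableD.
have disjB n : [disjoint (\big[setU/set0]_(k < n) F k) & F n].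
  apply/disj_setPS => x []; rewrite -bigcup_mkord => -[k /= kn Fk] Fn.
  have : (F k `&` F n) x by split.
  by move/trivIsetP : tF => /(_ k n Logic.I Logic.I (negbT (ltn_eqF kn))) ->.
have sumE n : (\sum_(0 <= i < n) psi_meas a (F i) = psi_meas a (\big[setU/set0]_(k < n) F k))%E.
  elim: n => [|n IH]; first by rewrite big_nil big_ord0 psi_meas0.
  by rewrite big_nat_recr//= IH big_ord_recr/= (psi_measU a (mB n) (mF n) (disjB n)).
have TE n : psi_meas a (\bigcup_k F k) = (psi_meas a (\big[setU/set0]_(k < n) F k) + psi_meas
  a (T n))%E.
  rewrite -psi_measU//; last by apply/disj_setPS => x [Bx [_ /(_ Bx)]].
  congr psi_meas; rewrite /T setDUK//.
  by rewrite -bigcup_mkord; apply: bigcup_sub => k _; exact: bigcup_sup.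
have aT : a (T n) @[n --> \oo] --> 0%E.
  have -> : 0%E = a (\bigcap_n T n).
    rewrite -[LHS](measure0 a); congr (a _); apply/seteqP; split => // x Tx.
    have [[k _ Fk] _] := Tx 0%N Logic.I.
    by have [_] := Tx k.+1 Logic.I; apply; rewrite big_ord_recr/=; right.
  apply: nonincreasing_cvg_mu => //.
  - by rewrite ltey_eq rm_fin.
  - exact: bigcapT_measurable.
  - move=> i j ij; apply/subsetPset; apply: setDS; exact: subset_bigsetU.
have psiT : psi_meas a (T n) @[n --> \oo] --> 0%E.
  apply: (@squeeze_cvge _ _ _ _ (cst 0%E) _ (fun n => C%:E * a (T n))%E).
  - by apply: nearW => n; rewrite psi_meas_ge0 psi_meas_le.
  - exact: cvg_cst.
  - by rewrite -(mule0 C%:E); apply: cvgeZl.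
rewrite (_ : (fun n => _) = (fun n => psi_meas a (\bigcup_k F k) - psi_meas a (T n))%E);
  last first.
  apply/funext => n; rewrite sumE (TE n) addeK// psi_meas_fin//.
rewrite -[X in _ --> X]sube0; apply: cvgeB => //.
  by rewrite fin_num_adde_defl.
exact: cvg_cst.
Qed.

HB.instance Definition _ a := isMeasure.Build _ _ _ (psi_meas a)
  (psi_meas0 a) (psi_meas_ge0 a) (@psi_meas_sigma_additive a).
HB.instance Definition _ a := @Measure_isFinite.Build _ _ _ (psi_meas a) (@psi_meas_fin a).

Lemma psi_meas_dominated a : psi_meas a `<< a.
Proof.
apply/null_content_dominatesP => E mE aE0.
apply/eqP; rewrite eq_le psi_meas_ge0 andbT.
by rewrite (le_trans (psi_meas_le a mE))// aE0 mule0.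
Qed.

(** The Radon-Nikodym derivative respects the bound almost everywhere, by the mass estimate;
    truncating it makes the bound hold at every point. [Num.max C 0] avoids a discussion of the sign
    of [C]. *)
Lemma psi_density a : exists h : borel G -> R,
  [/\ measurable_fun setT h, forall x, 0 <= h x <= Num.max C 0 &
    forall E, measurable E -> psi_meas a E = (\int[a]_(x in E) (h x)%:E)%E].
Proof.
have dom := @psi_meas_dominated a.
pose f := Radon_Nikodym_SigmaFinite.f (psi_meas a) a.
have f0 := Radon_Nikodym_SigmaFinite.f_ge0 dom.
have ffin := Radon_Nikodym_SigmaFinite.f_fin_num dom.
have fint := Radon_Nikodym_SigmaFinite.f_integrable dom.
have fE := Radon_Nikodym_SigmaFinite.f_integral dom.
have mf : measurable_fun setT f by exact: measurable_int fint.
set C0 := Num.max C 0.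
pose h x := Num.min (fine (f x)) C0.
have mh : measurable_fun setT h.
  by apply: measurable_minr; [exact: measurableT_comp|exact: measurable_cst].
exists h; split => //.
  move=> x; rewrite le_min fine_ge0 ?f0//= le_max lexx orbT/=.
  by rewrite ge_min lexx orbT.
move=> E mE; rewrite fE//.
pose A := [set x | C0%:E < f x]%E.
have mA : measurable A.
  by rewrite -[A]setTI; apply: emeasurable_fun_o_infty.
have aA : a A = 0%E.
  have -> : A = setT `&` [set x | (C0%:E < f x)%E] by rewrite setTI.
  apply: integral_le_measure0 => // B mB _.
  rewrite -fE//; apply: (le_trans (psi_meas_le a mB)).
  by rewrite lee_wpmul2r ?rm_ge0// lee_fin le_max lexx.
apply: ae_eq_integral => //.
- exact: measurable_funTS.
- by apply/measurable_EFinP; exact: measurable_funTS.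
exists A; split => // x /= /not_implyP[_]; apply: contra_notP => /negP.
rewrite -leNgt => fC.
by rewrite /h min_l; [rewrite fineK|rewrite -lee_fin fineK].
Qed.

End positive_functional.

Section density_measure.
Context d (T : measurableType d) (R : realType).
Context (mu : {measure set T -> \bar R}) (h : T -> R).
Hypothesis h_ge0 : forall x, 0 <= h x.
Hypothesis mh : measurable_fun setT h.

(** As for [pconv], the two proofs are phantom arguments from which the measure structure is
    inferred. *)
Definition density_measure & (forall x, 0 <= h x) & measurable_fun setT h :=
  fun E : set T => (\int[mu]_(x in E) (h x)%:E)%E.

Local Notation hmu := (density_measure h_ge0 mh).

Let density0 : hmu set0 = 0%E.
Proof. by rewrite /density_measure integral_set0. Qed.

Let density_ge0 E : (0 <= hmu E)%E.
Proof. by apply: integral_ge0 => x _; rewrite lee_fin. Qed.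

Let density_sigma_additive : semi_sigma_additive hmu.
Proof.
move=> F mF tF mUF.
rewrite [X in _ --> X](_ : _ = (\sum_(n <oo) hmu (F n))%E).
  by apply: is_cvg_ereal_nneg_natsum => n _; exact: density_ge0.
rewrite /density_measure ge0_integral_bigcup//.
- by apply/measurable_EFinP; exact: measurable_funTS.
- by move=> x _; rewrite lee_fin.
Qed.

HB.instance Definition _ := isMeasure.Build _ _ _ hmu
  density0 density_ge0 density_sigma_additive.

End density_measure.

Lemma measure_le_partition d (T : measurableType d) (R : realType)
    (m1 m2 : {measure set T -> \bar R}) (F : nat -> set T) :
  (forall k, measurable (F k)) -> trivIset setT F -> \bigcup_k F k = setT ->
  (forall k E, measurable E -> E `<=` F k -> (m1 E <= m2 E)%E) ->
  forall E, measurable E -> (m1 E <= m2 E)%E.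
Proof.
move=> mF tF FT H E mE.
have mEF k : measurable (E `&` F k) by exact: measurableI.
have tEF : trivIset setT (fun k => E `&` F k) by apply: trivIset_setIl.
have EE : E = \bigcup_k (E `&` F k) by rewrite -setI_bigcupr FT setIT.
have mU : measurable (\bigcup_k (E `&` F k)) by rewrite -EE.
rewrite EE !measure_semi_bigcup//.
by apply: lee_nneseries => [k _ _|k _]; [exact: measure_ge0|apply: (H k)].
Qed.

(** * One density for all measures dominated by the base *)

Section change_of_base.
Context (R : realType) (G : topologicalGroupType).
Hypothesis G_hausdorff : hausdorff_space G.
Implicit Types (a b c : rmeas R G).
Context (psi : rmeas R G -> R) (C : R).
Hypothesis psi_lin : rm_linear psi.
Hypothesis psi_ge0 : forall a, 0 <= psi a.
Hypothesis psi_le : forall a, psi a <= C * mass a.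

Local Notation psi_meas := (psi_measure G_hausdorff psi_lin psi_ge0 psi_le).

Lemma rm_linearZ_le (t : R) a b : 0 <= t ->
  (forall E, measurable E -> (a E <= t%:E * b E)%E) -> psi a <= t * psi b.
Proof.
move=> t0 ab; pose c := rlin G_hausdorff (NngNum t0) b (rzero _ _).
have cE E : c E = (t%:E * b E)%E by rewrite rlinE adde0.
have -> : t * psi b = psi c.
  rewrite (@psi_lin t b (rzero _ _) c t0); last by move=> E _; rewrite rlinE.
  by rewrite (rm_linear0 psi_lin (a := rzero _ _)) ?addr0.
by apply: (rm_linear_le G_hausdorff psi_lin psi_ge0) => // E mE; rewrite cE ab.
Qed.

Lemma rm_linearZ_ge (t : R) a b : 0 <= t ->
  (forall E, measurable E -> (t%:E * b E <= a E)%E) -> t * psi b <= psi a.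
Proof.
move=> t0 ab; pose c := rlin G_hausdorff (NngNum t0) b (rzero _ _).
have cE E : c E = (t%:E * b E)%E by rewrite rlinE adde0.
have -> : t * psi b = psi c.
  rewrite (@psi_lin t b (rzero _ _) c t0); last by move=> E _; rewrite rlinE.
  by rewrite (rm_linear0 psi_lin (a := rzero _ _)) ?addr0.
by apply: (rm_linear_le G_hausdorff psi_lin psi_ge0) => // E mE; rewrite cE ab.
Qed.

(* On E one has s a <= b <= (s + t) a, so that both sides lie between s psi(a|E) and
   (s + t) psi(a|E). *)
Lemma psi_change_level a b (g h : borel G -> R) (s t : R) (E : set (borel G)) :
  measurable_fun setT g -> measurable_fun setT h -> (forall x, 0 <= g x) -> (forall x,
    0 <= h x) ->
  (forall D, measurable D -> b D = \int[a]_(x in D) (g x)%:E)%E ->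
  (\int[b]_(x in E) (h x)%:E = \int[a]_(x in E) ((h x)%:E * (g x)%:E))%E ->
  (forall D, measurable D -> psi_meas a D = (\int[a]_(x in D) (h x)%:E)%E) ->
  0 <= s -> 0 <= t -> measurable E -> (forall x, E x -> s <= g x <= s + t) ->
  (psi_meas b E <= \int[b]_(x in E) (h x)%:E + t%:E * psi_meas a E)%E /\
  (\int[b]_(x in E) (h x)%:E <= psi_meas b E + t%:E * psi_meas a E)%E.
Proof.
move=> mg mh g0 h0 bE hE aE s0 t0 mE gst.
have mgD D : measurable_fun D (fun x => (g x)%:E).
  by apply/measurable_EFinP; exact: measurable_funTS.
have mhD D : measurable_fun D (fun x => (h x)%:E).
  by apply/measurable_EFinP; exact: measurable_funTS.
have st0 : 0 <= s + t by rewrite addr_ge0.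
have lo D : measurable D -> D `<=` E -> (s%:E * a D <= b D)%E.
  move=> mD DE; rewrite bE// -integral_cst//.
  apply: ge0_le_integral => //.
  by move=> x /DE /gst/andP[? _]; rewrite lee_fin.
have hi D : measurable D -> D `<=` E -> (b D <= (s + t)%:E * a D)%E.
  move=> mD DE; rewrite bE// -integral_cst//.
  apply: ge0_le_integral => //.
  - by move=> x _; rewrite lee_fin.
  - by move=> x /DE /gst/andP[_ ?]; rewrite lee_fin.
have alo : (s%:E * psi_meas a E <= psi_meas b E)%E.
  rewrite !(psi_measE G_hausdorff psi_lin psi_ge0 psi_le _ mE) -EFinM lee_fin;
    apply: rm_linearZ_ge => // D mD.
  by rewrite !rrestrE lo//; exact: measurableI.
have ahi : (psi_meas b E <= (s + t)%:E * psi_meas a E)%E.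
  rewrite !(psi_measE G_hausdorff psi_lin psi_ge0 psi_le _ mE) -EFinM lee_fin;
    apply: rm_linearZ_le => // D mD.
  by rewrite !rrestrE hi//; exact: measurableI.
have blo : (s%:E * psi_meas a E <= \int[b]_(x in E) (h x)%:E)%E.
  rewrite hE aE// -ge0_integralZl_EFin//; last by move=> x _; rewrite lee_fin.
  apply: ge0_le_integral => //.
  - by move=> x _; rewrite mule_ge0// lee_fin.
  - exact: emeasurable_funM.
  - exact: emeasurable_funM.
  - by move=> x /gst/andP[? _]; rewrite muleC lee_wpmul2l// lee_fin.
have bhi : (\int[b]_(x in E) (h x)%:E <= (s + t)%:E * psi_meas a E)%E.
  rewrite hE aE// -ge0_integralZl_EFin//; last by move=> x _; rewrite lee_fin.
  apply: ge0_le_integral => //.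
  - by move=> x _; rewrite mule_ge0// lee_fin.
  - exact: emeasurable_funM.
  - exact: emeasurable_funM.
  - by move=> x /gst/andP[_ ?]; rewrite muleC lee_wpmul2r// lee_fin.
have D : ((s + t)%:E * psi_meas a E = s%:E * psi_meas a E + t%:E * psi_meas a E)%E.
  by rewrite -ge0_muleDl ?lee_fin.
by split; [apply: (le_trans ahi)|apply: (le_trans bhi)]; rewrite D leeD2r.
Qed.

(** The range of g = db/da is cut into slices of width [t]. On each slice the two sides differ by at
    most [t] times the [psi_meas a] of the slice, so in all by at most [t * psi_meas a E], and [t]
    is arbitrarily small. *)
Lemma psi_change a b (h : borel G -> R) : b `<< a ->
  measurable_fun setT h -> (forall x, 0 <= h x) ->
  (forall D, measurable D -> psi_meas a D = (\int[a]_(x in D) (h x)%:E)%E) ->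
  forall E, measurable E -> psi_meas b E = (\int[b]_(x in E) (h x)%:E)%E.
Proof.
move=> dom mh h0 aE E mE.
pose f := Radon_Nikodym_SigmaFinite.f b a.
have f0 := Radon_Nikodym_SigmaFinite.f_ge0 dom.
have ffin := Radon_Nikodym_SigmaFinite.f_fin_num dom.
have fint := Radon_Nikodym_SigmaFinite.f_integrable dom.
have fE := Radon_Nikodym_SigmaFinite.f_integral dom.
pose g x := fine (f x).
have fg x : f x = (g x)%:E by rewrite fineK.
have mg : measurable_fun setT g.
  by apply: measurableT_comp => //; exact: measurable_int fint.
have g0 x : 0 <= g x by rewrite fine_ge0// f0.
have bE D : measurable D -> (b D = \int[a]_(x in D) (g x)%:E)%E.
  by move=> mD; rewrite [LHS]fE//; apply: eq_integral => x _; exact: fg.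
have hE D : measurable D ->
  (\int[b]_(x in D) (h x)%:E = \int[a]_(x in D) ((h x)%:E * (g x)%:E))%E.
  move=> mD; rewrite -(Radon_Nikodym_SigmaFinite.change_of_variables dom)//.
  - by apply: eq_integral => x _; rewrite -fg.
  - by apply/measurable_EFinP; exact: measurable_funTS.
have key (n : nat) : let t := n.+1%:R^-1 in
    (psi_meas b E <= \int[b]_(x in E) (h x)%:E + t%:E * psi_meas a E)%E /\
    (\int[b]_(x in E) (h x)%:E <= psi_meas b E + t%:E * psi_meas a E)%E.
  move=> t; have t0 : 0 < t by rewrite invr_gt0.
  pose F k := (fun x => Num.truncn (g x / t)) @^-1` [set k].
  have tF : trivIset setT F by apply: trivIset_preimage1.
  have FT : \bigcup_k F k = setT.
    by apply/seteqP; split => // x _; exists (Num.truncn (g x / t)).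
  have Fst k x : F k x -> k%:R * t <= g x <= k%:R * t + t.
    move=> Fx; have := @truncn_itv R (g x / t) (divr_ge0 (g0 x) (ltW t0)).
    rewrite [Num.truncn _]Fx ler_pdivlMr// ltr_pdivrMr// => /andP[-> /ltW].
    by rewrite -natr1 mulrDl mul1r.
  have mF k : measurable (F k).
    have mgt : measurable_fun setT (fun x => g x / t) by exact: measurable_funM.
    rewrite (_ : F k = setT `&` (fun x => g x / t) @^-1` `[k%:R, k.+1%:R[%classic).
      by apply: mgt => //; exact: measurable_itv.
    rewrite setTI; apply/seteqP; split => x /=.
      by move=> Fx; have := @truncn_itv R (g x / t) (divr_ge0 (g0 x) (ltW t0));
         rewrite [Num.truncn _]Fx in_itv.
    rewrite in_itv /= => kx; apply/eqP; rewrite truncn_eq ?kx//.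
    by rewrite divr_ge0// ltW.
  have nt : 0 <= t by exact: ltW.
  split.
  (* Each side is the value at [E] of a measure, which lets the estimates on the slices be added
     up. *)
  - pose m2 := measure_add (density_measure b h0 mh) (mscale (NngNum nt) (psi_meas a)).
    have m2E D : m2 D = (\int[b]_(x in D) (h x)%:E + t%:E * psi_meas a D)%E by exact:
      measure_addE.
    rewrite -m2E; apply: (measure_le_partition mF tF FT) => // k D mD DF.
    rewrite [leRHS]m2E.
    have kt0 : 0 <= k%:R * t by rewrite mulr_ge0.
    exact: (psi_change_level mg mh g0 h0 bE (hE _ mD) aE kt0 nt mD (fun x Dx =>
      Fst _ _ (DF _ Dx))).1.
  - pose m2 := measure_add (psi_meas b) (mscale (NngNum nt) (psi_meas a)).
    have m2E D : m2 D = (psi_meas b D + t%:E * psi_meas a D)%E by exact: measure_addE.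
    rewrite -m2E -[leLHS]/(density_measure b h0 mh E).
    apply: (measure_le_partition mF tF FT) => // k D mD DF.
    rewrite [leRHS]m2E.
    have kt0 : 0 <= k%:R * t by rewrite mulr_ge0.
    exact: (psi_change_level mg mh g0 h0 bE (hE _ mD) aE kt0 nt mD (fun x Dx =>
      Fst _ _ (DF _ Dx))).2.
have small (e : R) : 0 < e -> exists n : nat, ((n.+1%:R^-1)%:E * psi_meas a E <= e%:E)%E.
  move=> e0; rewrite (psi_measE G_hausdorff psi_lin psi_ge0 psi_le _ mE); set y := psi _.
  exists (Num.truncn (y / e)); rewrite -EFinM lee_fin ler_pdivrMl//.
  rewrite -ler_pdivrMr//; apply/ltW.
  by have /andP[] := @truncn_itv R (y / e) (divr_ge0 (psi_ge0 _) (ltW e0)).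
apply/eqP; rewrite eq_le; apply/andP; split; apply/lee_addgt0Pr => e /small[n ne];
  have [k1 k2] := key n.
- by apply: (le_trans k1); rewrite leeD2l.
- by apply: (le_trans k2); rewrite leeD2l.
Qed.

End change_of_base.

Section representation.
Context (R : realType) (G : topologicalGroupType).
Hypothesis G_hausdorff : hausdorff_space G.
Implicit Types (a b c : rmeas R G).

Lemma bounded_integrable a (h : borel G -> R) (B : R) (E : set (borel G)) :
  measurable E -> measurable_fun setT h -> (forall x, `|h x| <= B) ->
  a.-integrable E (EFin \o h).
Proof.
move=> mE mh hB; apply: measurable_bounded_integrable => //.
- by rewrite ltey_eq rm_fin.
- exact: measurable_funTS.
- exists B; split; first exact: num_real.
  by move=> y By x _; apply: (le_trans (hB x)); exact: ltW.
Qed.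

(** Adding [C * mass] makes the functional positive; the constant is subtracted again from the
    density. That one [h a] serves every b << a is the coherence demanded of a generalised
    function. *)
Lemma rm_representation (phi : rmeas R G -> R) (C : R) :
  rm_linear phi -> (forall a, `|phi a| <= C * mass a) ->
  exists (h : rmeas R G -> borel G -> R) (B : R), forall a,
    [/\ measurable_fun setT (h a), forall x, `|h a x| <= B &
      forall b E (mE : measurable E), b `<< a ->
        phi (rrestr G_hausdorff b mE) = \int[b]_(x in E) h a x].
Proof.
move=> phi_lin phi_le.
pose psi a := phi a + C * mass a.
have psi_lin : rm_linear psi.
  move=> t a b c t0 cab; rewrite /psi (phi_lin _ _ _ _ t0 cab).
  by rewrite (mass_linear t0 cab); ring.
have phi_le' a : - (C * mass a) <= phi a <= C * mass a by rewrite -ler_norml.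
have psi_ge0 a : 0 <= psi a by have := phi_le' a; rewrite /psi; lra.
have psi_le a : psi a <= (C + C) * mass a by have := phi_le' a; rewrite /psi; lra.
have /choice[h Hh] := psi_density G_hausdorff psi_lin psi_ge0 psi_le.
exists (fun a x => h a x - C), (Num.max (C + C) 0 + `|C|) => a.
have [mh hC hE] := Hh a; split.
- exact: measurable_funB.
- move=> x; have /andP[h0 hle] := hC x.
  by rewrite (le_trans (ler_normB _ _))// lerD2r ger0_norm.
move=> b E mE dom.
have h0 x : 0 <= h a x by case/andP: (hC x).
have := psi_change dom mh h0 hE mE.
rewrite psi_measE => Eh.
rewrite RintegralB//; last 2 first.
- apply: (@bounded_integrable _ _ (Num.max (C + C) 0)) => // x.
  by have /andP[h0' hle] := hC x; rewrite ger0_norm.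
- exact: finite_measure_integrable_cst.
rewrite Rintegral_cst//.
have -> : \int[b]_(x in E) h a x = psi (rrestr G_hausdorff b mE) by rewrite /Rintegral -Eh.
by rewrite /psi /mass rrestrE setTI; ring.
Qed.

End representation.

(** * Complex measures *)

Section complex_norm.
Context (R : realType).
Implicit Types (z : R[i]) (x y : R).

Lemma normc_le_add z : normc z <= `|complex.Re z| + `|complex.Im z|.
Proof.
case: z => x y /=; have h : 0 <= `|x| + `|y| by rewrite addr_ge0.
rewrite -[leRHS](ger0_norm h) -sqrtr_sqr ler_wsqrtr// sqrrD !real_normK ?num_real//.
by rewrite addrAC lerDl mulrn_wge0// mulr_ge0.
Qed.

Lemma ge_Re_normc z : `|complex.Re z| <= normc z.
Proof.
case: z => x y /=; rewrite -sqrtr_sqr; apply: ler_wsqrtr.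
by rewrite lerDl sqr_ge0.
Qed.

Lemma ge_Im_normc z : `|complex.Im z| <= normc z.
Proof.
case: z => x y /=; rewrite -sqrtr_sqr; apply: ler_wsqrtr.
by rewrite lerDr sqr_ge0.
Qed.

Lemma normc_ge0 z : 0 <= normc z.
Proof. exact: le_trans (normr_ge0 _) (ge_Re_normc z). Qed.

End complex_norm.

(** * Jordan parts and total variation *)

Section jordan_parts.
Context (R : realType) (G : topologicalGroupType).
Implicit Types (p q : {charge set (borel G) -> \bar R}) (a b c d : rmeas R G).

(** Built from the very choices made in [charge_int], so that [charge_intE] holds by computation. *)
Definition jpos p : {finite_measure set (borel G) -> \bar R} :=
  jordan_pos (svalP (cid (svalP (cid (Hahn_decomposition p))))).

Definition jneg p : {finite_measure set (borel G) -> \bar R} :=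
  jordan_neg (svalP (cid (svalP (cid (Hahn_decomposition p))))).

Lemma charge_intE p g : charge_int p g = Rintegral (jpos p) setT g - Rintegral (jneg p) setT g.
Proof. by []. Qed.

Lemma jposE p : exists2 P : set (borel G), measurable P &
  forall E, measurable E -> jpos p E = p (E `&` P).
Proof.
have [[mP _] _ _ _] := svalP (cid (svalP (cid (Hahn_decomposition p)))).
exists (sval (cid (Hahn_decomposition p))) => // E mE.
by rewrite /jpos/= jordan_posE cjordan_posE /crestr0 mem_set.
Qed.

Lemma jnegE p : exists2 P : set (borel G), measurable P &
  forall E, measurable E -> jneg p E = (- p (E `&` P))%E.
Proof.
have [_ [mN _] _ _] := svalP (cid (svalP (cid (Hahn_decomposition p)))).
exists (sval (cid (svalP (cid (Hahn_decomposition p))))) => // E mE.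
by rewrite /jneg/= jordan_negE cjordan_negE /crestr0 mem_set.
Qed.

Lemma jordanE p E : measurable E -> p E = (jpos p E - jneg p E)%E.
Proof.
move=> mE.
have := jordan_decomp (svalP (cid (svalP (cid (Hahn_decomposition p))))) mE.
by rewrite /cadd/= cscaleN1 => ->.
Qed.

(** Partition [E] into [A], the rest of [E], and empty sets. *)
Lemma tvar_ge p q (A E : set (borel G)) : measurable A -> measurable E -> A `<=` E ->
  ((normc (cval p q A))%:E <= tvar p q E)%E.
Proof.
move=> mA mE AE.
pose F (n : nat) : set (borel G) := if n is 0%N then A else if n is 1%N then E `\` A else set0.
apply: (@le_trans _ _ (\sum_(0 <= i <oo) (normc (cval p q (F i)))%:E)%E); last first.
  apply: ereal_sup_ubound; exists F; split => //.
  - by move=> [|[|n]] //=; exact: measurableD.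
  - apply/trivIsetP => -[|[|i]] [|[|j]] _ _ //= _; rewrite ?setI0 ?set0I//.
    + by apply/seteqP; split => // x [Ax [_ /(_ Ax)]].
    + by apply/seteqP; split => // x [[_ nA] /nA].
  - apply/seteqP; split => [x [[|[|n]] _ //= ]|x Ex].
    + exact: AE.
    + by case.
    + by have [Ax|nAx] := pselect (A x); [exists 0%N|exists 1%N].
rewrite (@nneseriesD1 _ _ 0%N)//; last by move=> k _; rewrite lee_fin normc_ge0.
rewrite leeDl//; apply: nneseries_ge0 => n _ _; by rewrite lee_fin normc_ge0.
Qed.

Lemma tvar_le p q (m : {measure set (borel G) -> \bar R}) E :
  (forall A, measurable A -> ((normc (cval p q A))%:E <= m A)%E) ->
  (tvar p q E <= m E)%E.
Proof.
move=> H; apply: ge_ereal_sup => _ [F [mF tF FE ->]].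
have <- : (\sum_(0 <= i <oo) m (F i))%E = m E.
  by rewrite -FE measure_semi_bigcup//; exact: bigcupT_measurable.
apply: lee_nneseries => [i _ _|i _]; first by rewrite lee_fin normc_ge0.
exact: H.
Qed.

Lemma jpos_le_tvar_re p q E : measurable E -> (jpos p E <= tvar p q E)%E.
Proof.
move=> mE; have [P mP PE] := jposE p.
rewrite PE//; apply: (le_trans _ (@tvar_ge p q (E `&` P) E _ _ _)) => //;
  last exact: measurableI.
have fp : p (E `&` P) \is a fin_num by rewrite fin_num_measure//; exact: measurableI.
rewrite -(fineK fp) lee_fin; apply: le_trans (ge_Re_normc _) => /=; exact: ler_norm.
Qed.

Lemma jneg_le_tvar_re p q E : measurable E -> (jneg p E <= tvar p q E)%E.
Proof.
move=> mE; have [P mP PE] := jnegE p.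
rewrite PE//; apply: (le_trans _ (@tvar_ge p q (E `&` P) E _ _ _)) => //;
  last exact: measurableI.
have fp : p (E `&` P) \is a fin_num by rewrite fin_num_measure//; exact: measurableI.
rewrite -(fineK fp) -EFinN lee_fin; apply: le_trans (ge_Re_normc _) => /=.
by rewrite -normrN; exact: ler_norm.
Qed.

Lemma jpos_le_tvar_im p q E : measurable E -> (jpos q E <= tvar p q E)%E.
Proof.
move=> mE; have [P mP PE] := jposE q.
rewrite PE//; apply: (le_trans _ (@tvar_ge p q (E `&` P) E _ _ _)) => //;
  last exact: measurableI.
have fp : q (E `&` P) \is a fin_num by rewrite fin_num_measure//; exact: measurableI.
rewrite -(fineK fp) lee_fin; apply: le_trans (ge_Im_normc _) => /=; exact: ler_norm.
Qed.

Lemma jneg_le_tvar_im p q E : measurable E -> (jneg q E <= tvar p q E)%E.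
Proof.
move=> mE; have [P mP PE] := jnegE q.
rewrite PE//; apply: (le_trans _ (@tvar_ge p q (E `&` P) E _ _ _)) => //;
  last exact: measurableI.
have fp : q (E `&` P) \is a fin_num by rewrite fin_num_measure//; exact: measurableI.
rewrite -(fineK fp) -EFinN lee_fin; apply: le_trans (ge_Im_normc _) => /=.
by rewrite -normrN; exact: ler_norm.
Qed.

End jordan_parts.

Section integral_linear_measure.
Context d (T : measurableType d) (R : realType).
Context (m a b : {measure set T -> \bar R}) (t : R).
Hypothesis t_ge0 : 0 <= t.
Hypothesis mE : forall E, measurable E -> m E = (t%:E * a E + b E)%E.

Lemma ge0_integral_lin (f : T -> \bar R) : measurable_fun setT f ->
  (forall x, 0 <= f x)%E ->
  (\int[m]_x f x = t%:E * \int[a]_x f x + \int[b]_x f x)%E.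
Proof.
move=> mf f0.
rewrite (eq_measure_integral (measure_add (mscale (NngNum t_ge0) a) b)).
  by rewrite ge0_integral_measure_add// ge0_integral_mscale.
by move=> E mE' _; rewrite mE//; exact/esym/(measure_addE (mscale (NngNum t_ge0) a) b).
Qed.

Lemma Rintegral_lin (g : T -> R) :
  a.-integrable setT (EFin \o g) -> b.-integrable setT (EFin \o g) ->
  \int[m]_x g x = t * \int[a]_x g x + \int[b]_x g x.
Proof.
move=> ag bg; have mg := measurable_int _ ag.
rewrite /Rintegral !(integralE _ _ (fun x => (g x)%:E)).
have [ap an] := (integrable_funepos measurableT ag, integrable_funeneg measurableT ag).
have [bp bn] := (integrable_funepos measurableT bg, integrable_funeneg measurableT bg).
have fap := integrable_fin_num measurableT ap; have fan := integrable_fin_num measurableT an.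
have fbp := integrable_fin_num measurableT bp; have fbn := integrable_fin_num measurableT bn.
rewrite !ge0_integral_lin//; [|exact: measurable_funeneg|exact: measurable_funepos].
move: fap fan fbp fbn; rewrite /comp.
case: (integral a _ _) => // r1 _; case: (integral a _ _) => // r2 _.
case: (integral b _ _) => // r3 _; case: (integral b _ _) => // r4 _ /=.
by ring.
Qed.

End integral_linear_measure.

Lemma integrable_le_measure d (T : measurableType d) (R : realType)
    (m a : {measure set T -> \bar R}) (g : T -> \bar R) :
  (forall E, measurable E -> m E <= a E)%E ->
  a.-integrable setT g -> m.-integrable setT g.
Proof.
move=> ma /integrableP[mg ag]; apply/integrableP; split => //.
apply: le_lt_trans ag; apply: ge0_le_measure_integral => //.
exact: measurableT_comp.
Qed.

Section charge_integral.
Context (R : realType) (G : topologicalGroupType).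
Implicit Types (p : {charge set (borel G) -> \bar R}).
Implicit Types (a b : {finite_measure set (borel G) -> \bar R}).

(** The Jordan decomposition is the smallest one: the positive part of [E] is p(E [&] P), which is
    at most a(E [&] P). *)
Lemma jpos_le p a b : (forall E, measurable E -> p E = (a E - b E)%E) ->
  forall E, measurable E -> (jpos p E <= a E)%E.
Proof.
move=> pE E mE; have [P mP ->//] := jposE p.
have mEP : measurable (E `&` P) by exact: measurableI.
rewrite pE//; apply: (@le_trans _ _ (a (E `&` P))).
  by rewrite leeBlDr ?fin_num_measure// leeDl.
by apply: le_measure; rewrite ?inE.
Qed.

Lemma jneg_le p a b : (forall E, measurable E -> p E = (a E - b E)%E) ->
  forall E, measurable E -> (jneg p E <= b E)%E.
Proof.
move=> pE E mE; have [P mP ->//] := jnegE p.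
have mEP : measurable (E `&` P) by exact: measurableI.
rewrite pE// fin_num_oppeB ?fin_num_measure//; apply: (@le_trans _ _ (b (E `&` P))).
  by rewrite addeC leeBlDr ?fin_num_measure// leeDl.
by apply: le_measure; rewrite ?inE.
Qed.

(** From p+ - p- = a - b, the sums p+ + b and p- + a are one measure [m]; integrating [g] against
    [m] in both ways and rearranging gives the formula. *)
Lemma charge_int_diff p a b (g : borel G -> R) :
  (forall E, measurable E -> p E = (a E - b E)%E) ->
  a.-integrable setT (EFin \o g) -> b.-integrable setT (EFin \o g) ->
  charge_int p g = \int[a]_x g x - \int[b]_x g x.
Proof.
move=> pE ag bg; rewrite charge_intE.
have pg := integrable_le_measure (jpos_le pE) ag.
have ng := integrable_le_measure (jneg_le pE) bg.
pose m := measure_add (jpos p) b.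
have m1 E : measurable E -> m E = (1%:E * jpos p E + b E)%E.
  by move=> _; rewrite mul1e; exact: measure_addE.
have m2 E : measurable E -> m E = (1%:E * jneg p E + a E)%E.
  move=> mE; rewrite m1// !mul1e.
  have := jordanE p mE; rewrite pE//.
  have : a E \is a fin_num by exact: fin_num_measure.
  have : b E \is a fin_num by exact: fin_num_measure.
  have : jpos p E \is a fin_num by exact: fin_num_measure.
  have : jneg p E \is a fin_num by exact: fin_num_measure.
  case: (jneg p E) => // r1 _; case: (jpos p E) => // r2 _.
  case: (b E) => // r3 _; case: (a E) => // r4 _ [h].
  by rewrite -!EFinD; congr EFin; lra.
have := Rintegral_lin ler01 m1 pg bg.
rewrite (Rintegral_lin ler01 m2 ng ag) !mul1r.
by lra.
Qed.

End charge_integral.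

Section rmeas_parts.
Context (R : realType) (G : topologicalGroupType).
Hypothesis G_hausdorff : hausdorff_space G.
Implicit Types (a b c d : rmeas R G) (mu nu : cmeasure R G).

Lemma Rintegral_rrestr a (E : set (borel G)) (mE : measurable E) (g : borel G -> R) :
  a.-integrable setT (EFin \o g) ->
  \int[rrestr G_hausdorff a mE]_x g x = \int[a]_(x in E) g x.
Proof.
move=> ag; rewrite /Rintegral; congr fine.
have ag' : (rrestr G_hausdorff a mE).-integrable setT (EFin \o g).
  by apply: integrable_le_measure ag => D mD; exact: rrestr_le.
rewrite (negligible_integral (measurableC mE) measurableT ag'); last first.
  by rewrite -[LHS]/(a (~` E `&` E)) setICl measure0.
rewrite setTD setCK; apply: eq_measure_integral => A mA AE.
by rewrite -[LHS]/(a (A `&` E)) setIidl.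
Qed.

Lemma mregular_tv mu (m : {finite_measure set (borel G) -> \bar R}) :
  (forall E, measurable E -> (m E <= tv mu E)%E) -> mregular m.
Proof.
move=> H E e mE e0; have [K [U [cK oU KE EU UK]]] := @cm_regular _ _ mu E e mE e0.
exists K, U; split => //; apply: le_lt_trans UK; apply: H.
by apply: measurableD; [exact: open_borel|exact: compact_borel].
Qed.

Definition re_pos mu : rmeas R G :=
  RMeas (mregular_tv (@jpos_le_tvar_re _ _ (cm_re mu) (cm_im mu))).
Definition re_neg mu : rmeas R G :=
  RMeas (mregular_tv (@jneg_le_tvar_re _ _ (cm_re mu) (cm_im mu))).
Definition im_pos mu : rmeas R G :=
  RMeas (mregular_tv (@jpos_le_tvar_im _ _ (cm_re mu) (cm_im mu))).
Definition im_neg mu : rmeas R G :=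
  RMeas (mregular_tv (@jneg_le_tvar_im _ _ (cm_re mu) (cm_im mu))).

Definition radd a b : rmeas R G := rlin G_hausdorff 1%:nng a b.

Lemma raddE a b E : radd a b E = (a E + b E)%E.
Proof. by rewrite /radd rlinE mul1e. Qed.

(** A substitute for the total variation that is visibly a regular measure. It has the same null
    Borel sets as [tv mu], and almost everywhere statements and absolute continuity depend on
    nothing else. *)
Definition lam mu : rmeas R G :=
  radd (radd (re_pos mu) (re_neg mu)) (radd (im_pos mu) (im_neg mu)).

Lemma lamE mu E :
  lam mu E = (re_pos mu E + re_neg mu E + (im_pos mu E + im_neg mu E))%E.
Proof. by rewrite /lam !raddE. Qed.

(** mu = (a - b) + i(c - d), not necessarily the Jordan decomposition: a convolution comes with a
    decomposition of another kind. *)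
Definition cm_is mu a b c d := forall E, measurable E ->
  cm_re mu E = (a E - b E)%E /\ cm_im mu E = (c E - d E)%E.

Lemma cm_is_jordan mu : cm_is mu (re_pos mu) (re_neg mu) (im_pos mu) (im_neg mu).
Proof. by move=> E mE; split; exact: jordanE. Qed.

Lemma cval_le_sum (p q : {charge set (borel G) -> \bar R}) a b c d E :
  measurable E -> p E = (a E - b E)%E -> q E = (c E - d E)%E ->
  ((normc (cval p q E))%:E <= a E + b E + (c E + d E))%E.
Proof.
move=> mE re im; rewrite /cval re im.
have := rm_ge0 a E; have := rm_ge0 b E; have := rm_ge0 c E; have := rm_ge0 d E.
have := rm_fin a mE; have := rm_fin b mE; have := rm_fin c mE; have := rm_fin d mE.
case: (d E) => // rd _; case: (c E) => // rc _; case: (b E) => // rb _; case: (a E) => // ra _.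
rewrite !lee_fin => d0 c0 b0 a0; apply: (le_trans (normc_le_add _)) => /=.
apply: lerD; apply: (le_trans (ler_normB _ _)); rewrite !ger0_norm//.
Qed.

Lemma tv_le_sum mu a b c d E : cm_is mu a b c d -> measurable E ->
  (tv mu E <= a E + b E + (c E + d E))%E.
Proof.
move=> mu4 mE; have <- : radd (radd a b) (radd c d) E = (a E + b E + (c E + d E))%E by
  rewrite !raddE.
apply: tvar_le => A mA.
rewrite [leRHS](_ : _ = (a A + b A + (c A + d A))%E); last by rewrite [LHS]raddE !raddE.
by have [re im] := mu4 A mA; exact: cval_le_sum.
Qed.

Lemma tv_null mu E : measurable E -> tv mu E = 0%E <-> lam mu E = 0%E.
Proof.
move=> mE; split=> [tv0|lam0].
  rewrite lamE; have Z (m : rmeas R G) : (m E <= tv mu E)%E -> m E = 0%E.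
    by rewrite tv0 => m0; apply/eqP; rewrite eq_le m0 rm_ge0.
  have -> : re_pos mu E = 0%E by apply: Z; exact: jpos_le_tvar_re.
  have -> : re_neg mu E = 0%E by apply: Z; exact: jneg_le_tvar_re.
  have -> : im_pos mu E = 0%E by apply: Z; exact: jpos_le_tvar_im.
  have -> : im_neg mu E = 0%E by apply: Z; exact: jneg_le_tvar_im.
  by rewrite !adde0.
apply/eqP; rewrite eq_le; apply/andP; split.
  by rewrite (le_trans (tv_le_sum (cm_is_jordan mu) mE))// -lamE lam0.
by apply: le_trans (tvar_ge _ _ mE mE (@subset_refl _ E)); rewrite lee_fin normc_ge0.
Qed.

Lemma ae_tv mu (P : borel G -> Prop) :
  (\forall x \ae tv mu, P x) <-> (\forall x \ae lam mu, P x).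
Proof.
by split => -[A [mA A0 PA]]; exists A; split => //; apply/tv_null.
Qed.

Lemma dominates_tv mu nu : tv mu `<< tv nu <-> lam mu `<< lam nu.
Proof.
split => dom A nullA B mB BA; apply/tv_null => //; apply: (dom A) => // D mD DA;
  by apply/tv_null => //; exact: nullA.
Qed.

Lemma mkcm_regular a b c d :
  regular_cmeasure
    (cadd (charge_of_finite_measure a) (copp (charge_of_finite_measure b)))
    (cadd (charge_of_finite_measure c) (copp (charge_of_finite_measure d))).
Proof.
move=> E e mE e0.
have [K [U [cK oU KE EU UK]]] := @rm_regular _ _ (radd (radd a b) (radd c d)) E e mE e0.
exists K, U; split => //; apply: le_lt_trans UK; apply: tvar_le => A mA.
rewrite [leRHS](_ : _ = (a A + b A + (c A + d A))%E); last by rewrite [LHS]raddE !raddE.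
exact: cval_le_sum.
Qed.

Definition mkcm a b c d : cmeasure R G := CMeasure (mkcm_regular a b c d).

Lemma mkcm_is a b c d : cm_is (mkcm a b c d) a b c d.
Proof. by []. Qed.

Lemma cm_is_le mu a b c d : cm_is mu a b c d -> forall E, measurable E ->
  (lam mu E <= radd (radd a b) (radd c d) E)%E.
Proof.
move=> mu4 E mE; rewrite lamE !raddE.
apply: leeD; apply: leeD.
- by apply: (@jpos_le _ _ _ a b) => // D /mu4[].
- by apply: (@jneg_le _ _ _ a b) => // D /mu4[].
- by apply: (@jpos_le _ _ _ c d) => // D /mu4[].
- by apply: (@jneg_le _ _ _ c d) => // D /mu4[].
Qed.

End rmeas_parts.

(** * Generalised functions as functionals on positive measures *)

Section complex_functionals.
Context (R : realType) (G : topologicalGroupType).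
Hypothesis G_hausdorff : hausdorff_space G.
Implicit Types (a b c d : rmeas R G) (mu nu : cmeasure R G).
Implicit Types (phi : rmeas R G -> R[i]).

Local Notation re_pos := (re_pos G_hausdorff).
Local Notation re_neg := (re_neg G_hausdorff).
Local Notation im_pos := (im_pos G_hausdorff).
Local Notation im_neg := (im_neg G_hausdorff).
Local Notation lam := (lam G_hausdorff).
Local Notation radd := (radd G_hausdorff).
Local Notation zero := (@rzero R G).

Definition rm_clinear phi := forall (t : R) a b c, 0 <= t ->
  (forall E, measurable E -> c E = (t%:E * a E + b E)%E) ->
  phi c = t%:C * phi a + phi b.

Definition rm_bounded phi (B : R) := forall a, normc (phi a) <= B * mass a.

Definition rm_vanishes phi := forall e : R, 0 < e -> exists2 K : set G, compact K &
  forall a, a K = 0%E -> normc (phi a) <= e * mass a.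

Lemma rm_clinear_Re phi : rm_clinear phi -> rm_linear (fun a => complex.Re (phi a)).
Proof.
move=> philin t a b c t0 cE; rewrite (philin t a b c t0 cE).
by case: (phi a) (phi b) => [x y] [x' y'] /=; rewrite mul0r subr0.
Qed.

Lemma rm_clinear_Im phi : rm_clinear phi -> rm_linear (fun a => complex.Im (phi a)).
Proof.
move=> philin t a b c t0 cE; rewrite (philin t a b c t0 cE).
by case: (phi a) (phi b) => [x y] [x' y'] /=; rewrite mul0r addr0.
Qed.

Lemma complexP (z w : R[i]) : complex.Re z = complex.Re w ->
  complex.Im z = complex.Im w -> z = w.
Proof. by case: z w => [x y] [x' y'] /= -> ->. Qed.

Lemma rm_clinear_ext phi a b : rm_clinear phi ->
  (forall E, measurable E -> a E = b E) -> phi a = phi b.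
Proof.
move=> lin ab; apply: complexP.
- by apply: (rm_linear_ext (rm_clinear_Re lin)).
- by apply: (rm_linear_ext (rm_clinear_Im lin)).
Qed.

Lemma rm_clinearD phi a b c : rm_clinear phi ->
  (forall E, measurable E -> c E = (a E + b E)%E) -> phi c = phi a + phi b.
Proof.
move=> lin cE; rewrite (lin 1 a b c) ?mul1r// => E mE.
by rewrite mul1e cE.
Qed.

Lemma rm_clinear0 phi : rm_clinear phi -> phi zero = 0.
Proof.
move=> lin; apply: complexP.
- by apply: (rm_linear0 (rm_clinear_Re lin)).
- by apply: (rm_linear0 (rm_clinear_Im lin)).
Qed.

(** For [phi] in [rm_clinear] this is its complex-linear extension to M(G); by [ext_is], any other
    decomposition of [mu] gives the same value. *)
Definition ext phi mu : R[i] :=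
  (phi (re_pos mu) - phi (re_neg mu)) + 'i%C * (phi (im_pos mu) - phi (im_neg mu)).

(** a - b = c - d is rewritten as a + d = c + b, an equality of positive measures to which
    additivity applies. *)
Lemma charge_parts_additive phi (p : {charge set (borel G) -> \bar R}) a b c d :
  rm_clinear phi ->
  (forall E, measurable E -> p E = (a E - b E)%E) ->
  (forall E, measurable E -> p E = (c E - d E)%E) ->
  phi a - phi b = phi c - phi d.
Proof.
move=> lin pab pcd.
suff : phi a + phi d = phi c + phi b.
  by move=> h; apply/eqP; rewrite subr_eq addrAC eq_sym subr_eq h.
rewrite -(@rm_clinearD phi a d (radd a d) lin); last by move=> E _; rewrite raddE.
apply: rm_clinearD => // E mE; rewrite raddE.
have := pab E mE; rewrite pcd//.
have := rm_fin a mE; have := rm_fin b mE; have := rm_fin c mE; have := rm_fin d mE.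
case: (d E) => // rd _; case: (c E) => // rc _; case: (b E) => // rb _; case: (a E) => // ra _.
by move=> [h]; rewrite -!EFinD; congr EFin; lra.
Qed.

Lemma ext_is phi mu a b c d : rm_clinear phi -> cm_is mu a b c d ->
  ext phi mu = (phi a - phi b) + 'i%C * (phi c - phi d).
Proof.
move=> lin mu4; have J := cm_is_jordan G_hausdorff mu.
rewrite /ext; congr (_ + 'i%C * _).
- by apply: (@charge_parts_additive _ (cm_re mu)) => // E mE; [case: (J E mE)|case: (mu4 E mE)].
- by apply: (@charge_parts_additive _ (cm_im mu)) => // E mE; [case: (J E mE)|case: (mu4 E mE)].
Qed.

Definition cm_of a : cmeasure R G := mkcm G_hausdorff a zero zero zero.

Lemma ext_cm_of phi a : rm_clinear phi -> ext phi (cm_of a) = phi a.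
Proof.
move=> lin; rewrite (ext_is lin (mkcm_is G_hausdorff a zero zero zero)).
by rewrite rm_clinear0// !subr0 mulr0 addr0.
Qed.

Lemma lam_cm_of a E : measurable E -> lam (cm_of a) E = a E.
Proof.
move=> mE; apply/eqP; rewrite eq_le; apply/andP; split.
  have := cm_is_le G_hausdorff (mkcm_is G_hausdorff a zero zero zero) mE.
  by rewrite !raddE !adde0.
have [re _] := cm_is_jordan G_hausdorff (cm_of a) mE.
have aE : cm_re (cm_of a) E = a E by rewrite (mkcm_is G_hausdorff a zero zero zero mE).1 sube0.
rewrite -aE re lamE; apply: (@le_trans _ _ (re_pos (cm_of a) E)).
  by rewrite leeBlDr ?rm_fin// leeDl// rm_ge0.
by rewrite -addeA leeDl// !adde_ge0 ?rm_ge0.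
Qed.

Definition Cint a (g : borel G -> R[i]) : R[i] :=
  (\int[a]_x complex.Re (g x)) +i* (\int[a]_x complex.Im (g x)).

Definition cintegrable a (g : borel G -> R[i]) :=
  a.-integrable setT (EFin \o (fun x => complex.Re (g x))) /\
  a.-integrable setT (EFin \o (fun x => complex.Im (g x))).

Lemma Cint_lin (t : R) a b c g : 0 <= t ->
  (forall E, measurable E -> c E = (t%:E * a E + b E)%E) ->
  cintegrable a g -> cintegrable b g ->
  Cint c g = t%:C * Cint a g + Cint b g.
Proof.
move=> t0 cE [aR aI] [bR bI]; apply: complexP => /=.
- by rewrite (Rintegral_lin t0 cE aR bR) mul0r subr0.
- by rewrite (Rintegral_lin t0 cE aI bI) mul0r addr0.
Qed.

Lemma cm_int_is mu a b c d g : cm_is mu a b c d ->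
  cintegrable a g -> cintegrable b g -> cintegrable c g -> cintegrable d g ->
  cm_int mu g = (Cint a g - Cint b g) + 'i%C * (Cint c g - Cint d g).
Proof.
move=> mu4 [aR aI] [bR bI] [cR cI] [dR dI].
have re E : measurable E -> cm_re mu E = (a E - b E)%E by move=> /mu4[].
have im E : measurable E -> cm_im mu E = (c E - d E)%E by move=> /mu4[].
rewrite /cm_int (charge_int_diff re aR bR) (charge_int_diff re aI bI).
rewrite (charge_int_diff im cR dR) (charge_int_diff im cI dI).
by apply: complexP => /=; ring.
Qed.

Lemma ae_dominated a b (P : borel G -> Prop) : b `<< a ->
  (\forall x \ae a, P x) -> \forall x \ae b, P x.
Proof.
move=> /null_content_dominatesP ba [A [mA A0 PA]]; exists A; split => //.
exact: ba.
Qed.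

Lemma ess_bounded_integrable a (u : borel G -> R) (B : R) :
  measurable_fun setT u -> (\forall x \ae a, `|u x| <= B) ->
  a.-integrable setT (EFin \o u).
Proof.
move=> mu uB; apply/integrableP; split; first exact/measurable_EFinP.
apply: (@le_lt_trans _ _ (\int[a]_x (cst `|B|%:E x))%E).
  apply: ae_ge0_le_integral => //.
  - by apply: measurableT_comp => //; exact/measurable_EFinP.
  - by move=> x _; rewrite lee_fin.
  - by apply: filterS uB => x uB _ /=; rewrite lee_fin (le_trans uB)// ler_norm.
by rewrite integral_cst//= ltey_eq fin_numM// rm_fin.
Qed.

Lemma ess_bounded_cintegrable a g (B : R) : cmeasurable g ->
  (\forall x \ae a, normc (g x) <= B) -> cintegrable a g.
Proof.
move=> [mR mI] gB; split; apply: (@ess_bounded_integrable _ _ B) => //.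
- by apply: filterS gB => x; exact: le_trans (ge_Re_normc _).
- by apply: filterS gB => x; exact: le_trans (ge_Im_normc _).
Qed.

Lemma Rintegral_ess_le a (u : borel G -> R) (B : R) :
  measurable_fun setT u -> (\forall x \ae a, `|u x| <= B) ->
  `|\int[a]_x u x| <= B * mass a.
Proof.
move=> mu uB; have iu := ess_bounded_integrable mu uB.
rewrite (le_trans (le_normr_Rintegral measurableT iu))//.
(* A negative bound can hold almost everywhere only for the zero measure. *)
have [B0|B0] := leP 0 B; last first.
  have aT0 : a setT = 0%E.
    have [A [mA A0 AP]] := uB; rewrite -A0; congr (a _).
    apply/seteqP; split => // x _; apply: AP => /= xB.
    by have := lt_le_trans B0 (le_trans (normr_ge0 _) xB); rewrite ltxx.
  have -> : \int[a]_x `|u x| = 0.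
    by rewrite /Rintegral null_set_integral//; apply/measurable_EFinP; exact: measurableT_comp.
  by rewrite /mass aT0 mulr0.
rewrite -lee_fin EFinM massE /Rintegral fineK; last first.
  by apply: integrable_fin_num => //; exact: integrable_norm.
rewrite -integral_cst//; apply: ae_ge0_le_integral => //.
- by apply/measurable_EFinP; exact: measurableT_comp.
- by apply: filterS uB => x uB _ /=; rewrite lee_fin.
Qed.

Lemma Cint_ess_le a g (B : R) : cmeasurable g ->
  (\forall x \ae a, normc (g x) <= B) -> normc (Cint a g) <= (B + B) * mass a.
Proof.
move=> [mR mI] gB; rewrite (le_trans (normc_le_add _))//= mulrDl lerD//.
- by apply: Rintegral_ess_le => //; apply: filterS gB => x; exact: le_trans (ge_Re_normc _).
- by apply: Rintegral_ess_le => //; apply: filterS gB => x; exact: le_trans (ge_Im_normc _).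
Qed.

End complex_functionals.

Section generalised_functions.
Context (R : realType) (G : topologicalGroupType).
Hypothesis G_hausdorff : hausdorff_space G.
Implicit Types (a b c d : rmeas R G) (mu nu : cmeasure R G).
Implicit Types (f : gfamily R G) (phi : rmeas R G -> R[i]).

Local Notation re_pos := (re_pos G_hausdorff).
Local Notation re_neg := (re_neg G_hausdorff).
Local Notation im_pos := (im_pos G_hausdorff).
Local Notation im_neg := (im_neg G_hausdorff).
Local Notation lam := (lam G_hausdorff).
Local Notation radd := (radd G_hausdorff).
Local Notation rrestr := (rrestr G_hausdorff).
Local Notation cm_of := (cm_of G_hausdorff).
Local Notation ext := (ext G_hausdorff).

Lemma le_dominated a b : (forall E, measurable E -> (a E <= b E)%E) -> a `<< b.
Proof.
move=> ab; apply/null_content_dominatesP => E mE bE0.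
by apply/eqP; rewrite eq_le measure_ge0 andbT -bE0; exact: ab.
Qed.

Lemma dominates_refl a : a `<< a.
Proof. by []. Qed.

Lemma Linf_ae_bound mu (g : borel G -> R[i]) : Linf mu g ->
  exists2 B : R, 0 <= B & \forall x \ae lam mu, normc (g x) <= B.
Proof.
case=> _ /ereal_inf_lt[_ [B [B0 gB] <-] _].
by exists B => //; apply/ae_tv.
Qed.

Lemma Linf_norm_le mu (g : borel G -> R[i]) (B : R) : 0 <= B ->
  (\forall x \ae lam mu, normc (g x) <= B) -> (Linf_norm mu g <= B%:E)%E.
Proof.
move=> B0 gB; apply: ereal_inf_lbound; exists B => //; split => //.
by apply/ae_tv; exact: gB.
Qed.

Definition gfun f a : R[i] := Cint a (f (cm_of a)).

(** Since a << |mu|, the coordinates of [f] at [a] and at [mu] agree [a]-almost everywhere. Several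
    measures can thus be integrated against one common coordinate. *)
Lemma GL_dominated f mu a : GL f -> a `<< lam mu ->
  cintegrable a (f mu) /\ gfun f a = Cint a (f mu).
Proof.
move=> [fL fae] dom.
have [B B0 fB] := Linf_ae_bound (fL mu).
have mf nu : cmeasurable (f nu) by case: (fL nu).
have fB' : \forall x \ae a, normc (f mu x) <= B by exact: ae_dominated fB.
split; first exact: ess_bounded_cintegrable fB'.
have ae : \forall x \ae a, f (cm_of a) x = f mu x.
  have : tv (cm_of a) `<< tv mu.
    apply/(dominates_tv G_hausdorff); apply: null_dominates_trans dom.
    by apply: le_dominated => E mE; rewrite lam_cm_of.
  move=> /fae /(ae_tv G_hausdorff) H.
  have : a `<< lam (cm_of a) by apply: le_dominated => E mE; rewrite lam_cm_of.
  by move=> /ae_dominated /(_ H); apply: filterS => x; apply.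
rewrite /gfun; apply: complexP => /=; rewrite /Rintegral; congr fine.
- apply: ae_eq_integral => //; [by apply/measurable_EFinP;
  case: (mf (cm_of a))|by apply/measurable_EFinP; case: (mf mu)|].
  by apply: filterS ae => x -> _.
- apply: ae_eq_integral => //; [by apply/measurable_EFinP;
  case: (mf (cm_of a))|by apply/measurable_EFinP; case: (mf mu)|].
  by apply: filterS ae => x -> _.
Qed.

Lemma le_lam_cm_of a b : (forall E, measurable E -> (a E <= b E)%E) -> a `<< lam (cm_of b).
Proof. by move=> ab; apply: le_dominated => E mE; rewrite lam_cm_of// ab. Qed.

(** All three measures are dominated by [w], so the coordinate of [f] at [w] computes the three
    values and linearity is that of the integral. *)
Lemma gfun_clinear f : GL f -> rm_clinear (gfun f).
Proof.
move=> fG t a b c t0 cE; pose w := radd a b.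
have aw : a `<< lam (cm_of w).
  by apply: le_lam_cm_of => E mE; rewrite raddE leeDl// rm_ge0.
have bw : b `<< lam (cm_of w).
  by apply: le_lam_cm_of => E mE; rewrite raddE leeDr// rm_ge0.
have cw : c `<< lam (cm_of w).
  apply/null_content_dominatesP => E mE wE0.
  have /eqP : lam (cm_of w) E = 0%E := wE0.
  rewrite lam_cm_of// raddE padde_eq0 ?rm_ge0// => /andP[/eqP a0 /eqP b0].
  by have -> : c E = 0%E by rewrite cE// a0 b0 mule0 adde0.
have [ia ->] := GL_dominated fG aw; have [ib ->] := GL_dominated fG bw.
by have [_ ->] := GL_dominated fG cw; exact: Cint_lin.
Qed.

Lemma re_pos_le mu E : measurable E -> (re_pos mu E <= lam mu E)%E.
Proof. by move=> mE; rewrite lamE -addeA leeDl// !adde_ge0 ?rm_ge0. Qed.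

Lemma re_neg_le mu E : measurable E -> (re_neg mu E <= lam mu E)%E.
Proof. by move=> mE; rewrite lamE addeAC leeDr// !adde_ge0 ?rm_ge0. Qed.

Lemma im_pos_le mu E : measurable E -> (im_pos mu E <= lam mu E)%E.
Proof. by move=> mE; rewrite lamE addeCA leeDl// !adde_ge0 ?rm_ge0. Qed.

Lemma im_neg_le mu E : measurable E -> (im_neg mu E <= lam mu E)%E.
Proof. by move=> mE; rewrite lamE addeA leeDr// !adde_ge0 ?rm_ge0. Qed.

Lemma pairing_ext f mu : GL f -> pairing f mu = ext (gfun f) mu.
Proof.
move=> fG.
have [i1 e1] := GL_dominated fG (le_dominated (@re_pos_le mu)).
have [i2 e2] := GL_dominated fG (le_dominated (@re_neg_le mu)).
have [i3 e3] := GL_dominated fG (le_dominated (@im_pos_le mu)).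
have [i4 e4] := GL_dominated fG (le_dominated (@im_neg_le mu)).
rewrite /pairing (cm_int_is (cm_is_jordan G_hausdorff mu) i1 i2 i3 i4).
by rewrite -e1 -e2 -e3 -e4.
Qed.

Lemma Cint_rrestr a (E : set (borel G)) (mE : measurable E) g : cintegrable a g ->
  Cint (rrestr a mE) g = (\int[a]_(x in E) complex.Re (g x)) +i* (\int[a]_(x in E) complex.Im
    (g x)).
Proof. by move=> [iR iI]; rewrite /Cint !Rintegral_rrestr. Qed.

Lemma ae_le_of_integral a (u : borel G -> R) (D : set (borel G)) (C : R) :
  measurable D -> a.-integrable setT (EFin \o u) ->
  (forall E, measurable E -> E `<=` D -> \int[a]_(x in E) u x <= C * fine (a E)) ->
  \forall x \ae a, D x -> u x <= C.
Proof.
move=> mD iu H; exists (D `&` [set x | (C%:E < (EFin \o u) x)%E]).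
have iuD : a.-integrable D (EFin \o u) by exact: integrableS iu.
split.
- by apply: emeasurable_fun_o_infty => //; exact: measurable_int iuD.
- apply: integral_le_measure0 => // E mE ED.
  have iuE : a.-integrable E (EFin \o u) by exact: integrableS iuD.
  rewrite -[leLHS]fineK; last exact: integrable_fin_num.
  by rewrite -(fineK (rm_fin a mE)) lee_fin; exact: H.
- by move=> x /= /not_implyP[Dx /negP]; rewrite -ltNge => uC; split => //=; rewrite lte_fin.
Qed.

(** The hypothesis, tested on the restrictions of [lam mu] to Borel sets off [K], bounds the
    integrals of the real and imaginary parts of [f mu] and of their opposites; hence these four
    functions are at most [C] almost everywhere off [K]. *)
Lemma GL_ae_bound f (K : set (borel G)) (C : R) : GL f -> measurable K ->
  (forall a, a K = 0%E -> normc (gfun f a) <= C * mass a) ->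
  forall mu, \forall x \ae lam mu, ~ K x -> normc (f mu x) <= C + C.
Proof.
move=> fG mK H mu; have mKC := measurableC mK.
have [[iR iI] _] := GL_dominated fG (@dominates_refl (lam mu)).
have key E : measurable E -> E `<=` ~` K ->
    normc ((\int[lam mu]_(x in E) complex.Re (f mu x)) +i*
           (\int[lam mu]_(x in E) complex.Im (f mu x))) <= C * fine (lam mu E).
  move=> mE EK; rewrite -(Cint_rrestr mE)//.
  have [_ <-] := @GL_dominated f mu (rrestr (lam mu) mE) fG (le_dominated (@rrestr_le _ _
    G_hausdorff (lam mu) _ mE)).
  have := H (rrestr (lam mu) mE); rewrite /mass !rrestrE setTI; apply.
  rewrite (_ : K `&` E = set0) ?measure0//.
  by apply/seteqP; split => // x [Kx /EK].
have b1 : \forall x \ae lam mu, (~` K) x -> complex.Re (f mu x) <= C.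
  apply: ae_le_of_integral => // E mE EK.
  by apply: le_trans (key E mE EK); apply: le_trans (ge_Re_normc _) => /=; exact: ler_norm.
have b2 : \forall x \ae lam mu, (~` K) x -> complex.Im (f mu x) <= C.
  apply: ae_le_of_integral => // E mE EK.
  by apply: le_trans (key E mE EK); apply: le_trans (ge_Im_normc _) => /=; exact: ler_norm.
have intN u E : measurable E -> (lam mu).-integrable setT (EFin \o u) ->
    \int[lam mu]_(x in E) (- u x) = - \int[lam mu]_(x in E) u x.
  move=> mE iu; rewrite -[RHS]mulN1r -RintegralZl//; last exact: integrableS iu.
  by apply: eq_Rintegral => x _; rewrite mulN1r.
have iN u : (lam mu).-integrable setT (EFin \o u) ->
  (lam mu).-integrable setT (EFin \o (fun x => - u x)).
  exact: integrableN.
have b3 : \forall x \ae lam mu, (~` K) x -> - complex.Re (f mu x) <= C.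
  apply: ae_le_of_integral => //; first exact: iN.
  move=> E mE EK; rewrite intN//.
  by apply: le_trans (key E mE EK); apply: le_trans (ge_Re_normc _) => /=;
    rewrite -normrN ler_norm.
have b4 : \forall x \ae lam mu, (~` K) x -> - complex.Im (f mu x) <= C.
  apply: ae_le_of_integral => //; first exact: iN.
  move=> E mE EK; rewrite intN//.
  by apply: le_trans (key E mE EK); apply: le_trans (ge_Im_normc _) => /=;
    rewrite -normrN ler_norm.
near=> x => Kx; rewrite (le_trans (normc_le_add _))// lerD// ler_norml lerNl.
- by apply/andP; split; [apply: (near b3 x)|apply: (near b1 x)].
- by apply/andP; split; [apply: (near b4 x)|apply: (near b2 x)].
Unshelve. all: by end_near. Qed.

(** Surjectivity of GL(G) -> M(G)^*: the coordinate at [mu] is the density at the base measure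
    [lam mu]. *)
Lemma representation_exists phi (C : R) : rm_clinear phi -> rm_bounded phi C ->
  exists h, represents h (ext phi).
Proof.
move=> lin bnd.
have [hR [BR HR]] := @rm_representation _ _ G_hausdorff _ C (rm_clinear_Re lin)
  (fun a => le_trans (ge_Re_normc _) (bnd a)).
have [hI [BI HI]] := @rm_representation _ _ G_hausdorff _ C (rm_clinear_Im lin)
  (fun a => le_trans (ge_Im_normc _) (bnd a)).
pose h : gfamily R G := fun mu x => hR (lam mu) x +i* hI (lam mu) x.
have hG : GL h.
  split=> [mu|mu nu /(dominates_tv G_hausdorff) dom].
    have [mR bR _] := HR (lam mu); have [mI bI _] := HI (lam mu).
    split; first by split.
    apply: (@le_lt_trans _ _ (`|BR| + `|BI|)%:E); last by rewrite ltry.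
    apply: Linf_norm_le; first by rewrite addr_ge0.
    apply: aeW => x; rewrite (le_trans (normc_le_add _))//= lerD//.
    - by rewrite (le_trans (bR x))// ler_norm.
    - by rewrite (le_trans (bI x))// ler_norm.
  apply/(ae_tv G_hausdorff).
  (* For mu << nu the densities at [lam mu] and [lam nu] have the same [lam mu]-integral over every
     Borel set, so they agree almost everywhere. [k] is either the real or the imaginary density. *)
  have eqh (k : rmeas R G -> borel G -> R) (B : R) (psi : rmeas R G -> R) :
      (forall a, [/\ measurable_fun setT (k a), forall x, `|k a x| <= B &
        forall b E (mE : measurable E), b `<< a ->
          psi (rrestr b mE) = \int[b]_(x in E) k a x]) ->
      \forall x \ae lam mu, k (lam mu) x = k (lam nu) x.
    move=> H; have [m1 b1 e1] := H (lam mu); have [m2 b2 e2] := H (lam nu).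
    have i1 E : measurable E -> (lam mu).-integrable E (EFin \o k (lam mu)).
      by move=> mE; exact: bounded_integrable b1.
    have i2 E : measurable E -> (lam mu).-integrable E (EFin \o k (lam nu)).
      by move=> mE; exact: bounded_integrable b2.
    have : ae_eq (lam mu) setT (EFin \o k (lam mu)) (EFin \o k (lam nu)).
      apply: integral_ae_eq => //; first exact: i1.
        exact/measurable_EFinP.
      move=> E _ mE.
      rewrite -[LHS](fineK (integrable_fin_num mE (i1 _ mE))).
      rewrite -[RHS](fineK (integrable_fin_num mE (i2 _ mE))); congr EFin.
      have := e1 _ _ mE (@dominates_refl (lam mu)).
      by rewrite (e2 _ _ mE dom) => kk; exact: esym kk.
    by apply: filterS => x /(_ Logic.I) [].
  have a1 := eqh _ _ (fun a => complex.Re (phi a)) HR.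
  have a2 := eqh _ _ (fun a => complex.Im (phi a)) HI.
  by near=> x => _; rewrite /h (near a1 x)// (near a2 x).
exists h; split => // mu.
suff hphi a : gfun h a = phi a by rewrite pairing_ext// /ext !hphi.
have dom : a `<< lam (cm_of a) by apply: le_lam_cm_of => E _.
have aT E : measurable E -> rrestr a measurableT E = a E by move=> mE; rewrite rrestrE setIT.
have [_ _ /(_ a _ measurableT dom)] := HR (lam (cm_of a)).
have [_ _ /(_ a _ measurableT dom)] := HI (lam (cm_of a)).
rewrite (rm_clinear_ext lin aT) => eI eR.
by apply: complexP => /=; rewrite ?eI ?eR.
Unshelve. all: by end_near. Qed.

Lemma represents_gfun h phi : rm_clinear phi -> represents h (ext phi) ->
  forall a, gfun h a = phi a.
Proof.
move=> lin [hG hphi] a; rewrite -(ext_cm_of G_hausdorff a lin) -hphi pairing_ext//.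
by rewrite ext_cm_of//; exact: gfun_clinear.
Qed.

End generalised_functions.

(** * Countable families of measures and bounds on generalised functions *)

Section countable_domination.
Context (R : realType) (G : topologicalGroupType).
Hypothesis G_hausdorff : hausdorff_space G.

(** A convergent sum of positive multiples of the [a n]. It is regular because its partial sums are
    and the mass of the tail is small, uniformly over Borel sets. *)
Lemma countable_dominant (a : nat -> rmeas R G) :
  exists w : rmeas R G, forall n, a n `<< w.
Proof.
(* Weights that keep the total mass at most 1; the 1 added to the mass allows for zero measures. *)
pose t n : R := 1 / (2 ^ n.+1)%:R / (mass (a n) + 1).
have m1 n : 0 < mass (a n) + 1 by rewrite ltr_wpDl// mass_ge0.
have p2 n : 0 < (2 ^ n.+1)%:R :> R by rewrite ltr0n expn_gt0.
have t0 n : 0 < t n by rewrite !divr_gt0.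
pose m n : {measure set (borel G) -> \bar R} := mscale (NngNum (ltW (t0 n))) (a n).
have mE n E : m n E = ((t n)%:E * a n E)%E by [].
pose w := mseries m 0.
have wE E : w E = (\sum_(0 <= n <oo) m n E)%E by [].
have wT : (w setT < +oo)%E.
  apply: (@le_lt_trans _ _ 1%E); last by rewrite ltry.
  rewrite wE; apply: le_trans (epsilon_trick0 xpredT (@ler01 R)).
  apply: lee_nneseries => [n _ _|n _]; first exact: measure_ge0.
  rewrite mE -massE -EFinM lee_fin /t -[leLHS]mulrA -[leRHS]mulr1 ler_wpM2l//.
  by rewrite mulrC ler_pdivrMr// mul1r lerDl.
have finw : fin_num_fun w by exact: lty_fin_num_fun.
pose W : {finite_measure set (borel G) -> \bar R} :=
  HB.pack w (@Measure_isFinite.Build _ _ _ w finw).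
have WE E : W E = (\sum_(0 <= n <oo) m n E)%E by [].
pose fix s (N : nat) : rmeas R G :=
  if N is n.+1 then rlin G_hausdorff (NngNum (ltW (t0 n))) (a n) (s n) else rzero R G.
have sE N E : s N E = (\sum_(0 <= n < N) m n E)%E.
  elim: N => [|N IH]; first by rewrite big_nil.
  have -> : s N.+1 E = ((t N)%:E * a N E + s N E)%E by exact: rlinE.
  by rewrite big_nat_recr//= IH addeC.
have Wreg : mregular W.
  apply: mregular_le_add => // e e0.
  have tl := @nneseries_tail_cvg R (fun n => m n setT) xpredT wT (fun k _ =>
    measure_ge0 (m k) setT).
  have [N _ HN] : \forall N \near \oo, ((\sum_(N <= k <oo) m k setT)%E < e%:E)%E.
    apply: (tl [set x | (x < e%:E)%E]); apply: open_nbhs_nbhs; split => /=.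
      exact: open_ereal_lt_ereal.
    by rewrite lte_fin.
  exists (s N) => [|E mEE]; first exact: rm_regular.
  rewrite WE (@nneseries_split _ _ 0%N N); last by move=> k _; exact: measure_ge0.
  rewrite add0n sE leeD2l//; apply: (le_trans _ (ltW (HN N (leqnn N)))).
  apply: lee_nneseries => [n _ _|n _]; first exact: measure_ge0.
  by apply: le_measure; rewrite ?inE.
exists (RMeas Wreg) => n; apply/null_content_dominatesP => E mEE WE0.
have : m n E = 0%E.
  apply/eqP; rewrite eq_le measure_ge0 andbT.
  have <- : (\sum_(0 <= k <oo) m k E)%E = 0%E by exact: WE0.
  rewrite (@nneseriesD1 _ _ n)//.
  by rewrite leeDl//; apply: nneseries_ge0 => k _ _; exact: measure_ge0.
rewrite mE => /eqP; rewrite mule_eq0 => /orP[|/eqP//].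
by rewrite eqe gt_eqF.
Qed.

End countable_domination.

Section GL0_functionals.
Context (R : realType) (G : topologicalGroupType).
Hypothesis G_hausdorff : hausdorff_space G.
Implicit Types (a b c d : rmeas R G) (mu nu : cmeasure R G).
Implicit Types (f : gfamily R G) (phi : rmeas R G -> R[i]).

Local Notation lam := (lam G_hausdorff).
Local Notation cm_of := (cm_of G_hausdorff).
Local Notation ext := (ext G_hausdorff).
Local Notation gfun := (gfun G_hausdorff).

Definition GL0_functional phi :=
  [/\ rm_clinear phi, exists2 B : R, 0 <= B & rm_bounded phi B & rm_vanishes phi].

(* Otherwise some a_n satisfy |f(a_n)| > n |a_n|, and f would be unbounded
   almost everywhere for a measure dominating all of them. *)
Lemma GL_bounded f : GL f -> exists2 B : R, 0 <= B & rm_bounded (gfun f) B.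
Proof.
move=> fG; apply: contrapT => H.
have /choice[a Ha] (n : nat) : exists a, n%:R * mass a < normc (gfun f a).
  apply: contrapT => Hn; apply: H; exists n%:R => // a.
  by rewrite leNgt; apply/negP => na; apply: Hn; exists a.
have [w aw] := countable_dominant G_hausdorff a.
have aw' n : a n `<< lam (cm_of w).
  apply: null_dominates_trans (aw n) _; apply: le_dominated => E mE.
  by rewrite lam_cm_of.
have [fL _] := fG.
have [B B0 fB] := Linf_ae_bound G_hausdorff (fL (cm_of w)).
have bnd n : normc (gfun f (a n)) <= (B + B) * mass (a n).
  have [_ ->] := GL_dominated fG (aw' n).
  apply: Cint_ess_le; first by case: (fL (cm_of w)).
  exact: ae_dominated (aw' n) fB.
have BB : 0 <= B + B by rewrite addr_ge0.
have /andP[_ lt] := truncn_itv BB; set n := (Num.truncn (B + B)).+1 in lt.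
have := lt_le_trans (Ha n) (bnd n).
by rewrite ltNge ler_wpM2r// ?mass_ge0// ltW.
Qed.

Lemma GL0_gfun f : GL0 f -> GL0_functional (gfun f).
Proof.
move=> [fG fv]; split; [exact: gfun_clinear|exact: GL_bounded|].
(* Half of [e], because [Cint_ess_le] doubles the bound. *)
move=> e e0; have [K cK HK] := fv (e / 2) (divr_gt0 e0 (ltr0Sn _ 1)).
exists K => // a aK.
have /ereal_inf_lt[_ [B [B0 /(ae_tv G_hausdorff) fB] <-]] := HK (cm_of a).
rewrite lte_fin => Be.
have [fL _] := fG.
have aa : a `<< lam (cm_of a) by apply: le_lam_cm_of.
rewrite (le_trans (Cint_ess_le _ (B := B) _)) //.
- by case: (fL (cm_of a)).
- have nK : \forall x \ae a, ~ K x.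
    by exists K; split => //; [exact: compact_borel|move=> x /= /contrapT].
  apply: filterS2 (ae_dominated aa fB) nK => x /= + nKx.
  by rewrite indicE mem_set// mulr1.
- by rewrite ler_wpM2r ?mass_ge0//; lra.
Qed.

Lemma GL_of_functional phi : rm_clinear phi ->
  (exists2 B : R, 0 <= B & rm_bounded phi B) -> represents (GL_of (ext phi)) (ext phi).
Proof.
move=> lin [B B0 bnd]; have := representation_exists G_hausdorff lin bnd.
exact: xgetPex.
Qed.

Lemma gfun_GL_of phi : rm_clinear phi ->
  (exists2 B : R, 0 <= B & rm_bounded phi B) -> forall a, gfun (GL_of (ext phi)) a = phi a.
Proof.
by move=> lin bnd; apply: represents_gfun => //; exact: GL_of_functional.
Qed.

Lemma GL0_of_gfun f phi : GL f -> (forall a, gfun f a = phi a) -> rm_vanishes phi -> GL0 f.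
Proof.
move=> fG fphi phiv; split => // e e0.
(* [GL_ae_bound] doubles the bound to [e / 2], and the norm must be strictly below [e]. *)
have [K cK HK] := phiv (e / 4) (divr_gt0 e0 (ltr0Sn _ 3)).
exists K => // mu; apply: (@le_lt_trans _ _ (e / 4 + e / 4)%:E); last by rewrite lte_fin; lra.
apply: (Linf_norm_le (G_hausdorff := G_hausdorff)); first by lra.
have mK := compact_borel G_hausdorff cK.
have HK' a : a K = 0%E -> normc (gfun f a) <= e / 4 * mass a by rewrite fphi; exact: HK.
apply: filterS (GL_ae_bound fG mK HK' mu) => x Hx.
rewrite indicE; have [nKx|Kx] := pselect (~ K x).
  by rewrite mem_set// mulr1 Hx.
by rewrite memNset// mulr0 normc0; lra.
Qed.

Lemma GL0_GL_of phi : GL0_functional phi -> GL0 (GL_of (ext phi)).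
Proof.
move=> [lin bnd van]; have [hG _] := GL_of_functional lin bnd.
by apply: (GL0_of_gfun hG _ van) => a; exact: gfun_GL_of.
Qed.

Lemma GL_norm_le f (B : R) : GL f -> 0 <= B -> rm_bounded (gfun f) B ->
  (GL_norm f <= (B + B)%:E)%E.
Proof.
move=> fG B0 fB; apply: ge_ereal_sup => _ [mu _ <-].
apply: (Linf_norm_le (G_hausdorff := G_hausdorff)); first by rewrite addr_ge0.
have := GL_ae_bound fG (@measurable0 _ (borel G)) (fun a _ => fB a) mu.
by apply: filterS => x; apply.
Qed.

End GL0_functionals.

(** * Convolution of complex measures *)

Section convolution.
Context (R : realType) (G : topologicalGroupType).
Hypothesis G_hausdorff : hausdorff_space G.
Hypothesis G_locally_compact : locally_compact [set: G].
Implicit Types (a b c d : rmeas R G) (ze mu nu : cmeasure R G).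
Implicit Types (f : gfamily R G) (phi : rmeas R G -> R[i]).

Local Notation re_pos := (re_pos G_hausdorff).
Local Notation re_neg := (re_neg G_hausdorff).
Local Notation im_pos := (im_pos G_hausdorff).
Local Notation im_neg := (im_neg G_hausdorff).
Local Notation radd := (radd G_hausdorff).
Local Notation ext := (ext G_hausdorff).
Local Notation conv := (rconv G_hausdorff G_locally_compact).

Lemma rconvE a b E : conv a b E = (\int[a]_x b (ltrans x E))%E.
Proof. by []. Qed.

Lemma rconv_linl (t : R) a b c d : 0 <= t ->
  (forall E, measurable E -> c E = (t%:E * a E + b E)%E) ->
  forall E, measurable E -> conv c d E = (t%:E * conv a d E + conv b d E)%E.
Proof.
move=> t0 cE E mE; rewrite !rconvE.
by rewrite (ge0_integral_lin t0 cE)//; exact: measurable_fun_ltrans.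
Qed.

Lemma rconv_linr (t : R) a b c d : 0 <= t ->
  (forall E, measurable E -> c E = (t%:E * a E + b E)%E) ->
  forall E, measurable E -> conv d c E = (t%:E * conv d a E + conv d b E)%E.
Proof.
move=> t0 cE E mE; rewrite !rconvE.
have ma m := measurable_fun_ltrans G_hausdorff m mE.
rewrite -ge0_integralZl_EFin// -ge0_integralD//.
- by apply: eq_integral => x _; rewrite cE//; exact: measurable_ltrans.
- by move=> x _; rewrite mule_ge0 ?lee_fin.
- by apply: emeasurable_funM => //; exact: measurable_cst.
Qed.

Lemma mass_rconv a b : mass (conv a b) = mass a * mass b.
Proof. by apply: EFin_inj; rewrite EFinM !massE; exact: pconvT. Qed.

Lemma rconv_null a b (A D : set (borel G)) : measurable A -> measurable D ->
  a A = 0%E -> (forall x, ~ A x -> b (ltrans x D) = 0%E) -> conv a b D = 0%E.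
Proof.
move=> mA mD a0 H; rewrite rconvE.
have mb := measurable_fun_ltrans G_hausdorff b mD.
rewrite (ae_eq_integral (cst 0%E))//; first by rewrite integral0.
exists A; split => // x /= /not_implyP[_ bx]; apply: contrapT => nAx.
by apply: bx; rewrite H.
Qed.

Lemma compact_invg (C : set G) : compact C -> compact ((fun x : G => x^-1%g) @` C).
Proof.
move=> cC; apply: continuous_compact => //.
by apply: continuous_subspaceT; exact: invg_continuous.
Qed.

(** For [x] outside D C^-1 the set x^-1 D misses [C]; for [x] in [C] it lies in C^-1 D. In either
    case the integrand defining the convolution vanishes for almost every [x]. *)
Lemma rconv_support (C D : set G) : compact C -> compact D ->
  exists2 K : set G, compact K & forall a b,
    (a K = 0%E /\ b (~` C) = 0%E) \/ (a (~` C) = 0%E /\ b K = 0%E) ->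
    conv a b D = 0%E.
Proof.
move=> cC cD; have cCV := compact_invg cC.
pose K1 := [set z : G | exists x y, [/\ D x, ((fun x : G => x^-1%g) @` C) y & z = (x * y)%g]].
pose K2 := [set z : G | exists x y, [/\ ((fun x : G => x^-1%g) @` C) x, D y & z = (x * y)%g]].
have cK1 : compact K1 by exact: compact_mulg.
have cK2 : compact K2 by exact: compact_mulg.
have mC := compact_borel G_hausdorff cC.
have mCC := measurableC mC.
have mD := compact_borel G_hausdorff cD.
have cK := compactU cK1 cK2; have mK := compact_borel G_hausdorff cK.
have null0 (m : rmeas R G) (A B : set (borel G)) : measurable A -> measurable B ->
  A `<=` B -> m B = 0%E -> m A = 0%E.
  by move=> mA mB AB mB0; apply/eqP; rewrite eq_le (rm_ge0 m) andbT -mB0; exact: rm_le.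
exists (K1 `|` K2) => // a b [[aK bC]|[aC bK]].
- apply: (rconv_null mK mD aK) => x nKx.
  apply: (null0 b _ (~` C)) => //; first exact: measurable_ltrans.
  move=> y Dxy Cy; apply: nKx; left; exists (x * y)%g, (y^-1)%g; split => //.
    by exists y.
  by rewrite mulgK.
- apply: (rconv_null mCC mD aC) => x /contrapT Cx.
  apply: (null0 b _ (K1 `|` K2)) => //; first exact: measurable_ltrans.
  move=> y Dxy; right; exists (x^-1)%g, (x * y)%g; split => //.
    by exists x.
  by rewrite mulKg.
Qed.

Lemma Rintegral_ltrans a b E : measurable E ->
  a.-integrable setT (EFin \o (fun x : borel G => fine (b (ltrans x E)))) /\
  \int[a]_x fine (b (ltrans x E)) = fine (conv a b E).
Proof.
move=> mE; have mb := measurable_fun_ltrans G_hausdorff b mE.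
have bE x : (fine (b (ltrans x E)))%:E = b (ltrans x E).
  by rewrite fineK// rm_fin//; exact: measurable_ltrans.
split; last by rewrite /Rintegral rconvE; congr fine; apply: eq_integral => x _; exact: bE.
apply: (@bounded_integrable _ _ _ _ (mass b)) => //.
  exact: measurableT_comp.
move=> x; rewrite ger0_norm ?fine_ge0 ?rm_ge0// -lee_fin bE massE.
by apply: rm_le => //; exact: measurable_ltrans.
Qed.

Lemma Cint_ltrans a mu E : measurable E ->
  let g := fun x : borel G => cm_val mu (ltrans x E) in
  cintegrable a g /\
  Cint a g = (fine (conv a (re_pos mu) E) - fine (conv a (re_neg mu) E)) +i*
             (fine (conv a (im_pos mu) E) - fine (conv a (im_neg mu) E)).
Proof.
move=> mE g.
have mx x := measurable_ltrans x mE.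
have gRe x : complex.Re (g x) = fine (re_pos mu (ltrans x E)) - fine (re_neg mu (ltrans x E)).
  have [re _] := cm_is_jordan G_hausdorff mu (mx x).
  by rewrite /g /cm_val /cval /= re fineB// rm_fin.
have gIm x : complex.Im (g x) = fine (im_pos mu (ltrans x E)) - fine (im_neg mu (ltrans x E)).
  have [_ im] := cm_is_jordan G_hausdorff mu (mx x).
  by rewrite /g /cm_val /cval /= im fineB// rm_fin.
have [i1 e1] := Rintegral_ltrans a (re_pos mu) mE.
have [i2 e2] := Rintegral_ltrans a (re_neg mu) mE.
have [i3 e3] := Rintegral_ltrans a (im_pos mu) mE.
have [i4 e4] := Rintegral_ltrans a (im_neg mu) mE.
rewrite /cintegrable /Cint (funext gRe) (funext gIm) -e1 -e2 -e3 -e4; split.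
  split.
  - by have := integrableB measurableT i1 i2.
  - by have := integrableB measurableT i3 i4.
by rewrite (RintegralB measurableT i1 i2) (RintegralB measurableT i3 i4).
Qed.

Definition sum4 a b c d := radd (radd a b) (radd c d).

Lemma sum4_fine a b c d E : measurable E ->
  fine (sum4 a b c d E) = fine (a E) + fine (b E) + (fine (c E) + fine (d E)).
Proof. by move=> mE; rewrite !raddE !fineD ?fin_numD ?rm_fin. Qed.

(** The sixteen convolutions of Jordan parts, sorted by sign and by power of i. The complex measure
    assembled from them satisfies the equation defining [convol], so [xget] does not return its
    default, and the equation fixes the values on Borel sets. *)
Lemma convol_is ze mu :
  cm_is (convol ze mu)
    (sum4 (conv (re_pos ze) (re_pos mu)) (conv (re_neg ze) (re_neg mu))
          (conv (im_pos ze) (im_neg mu)) (conv (im_neg ze) (im_pos mu)))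
    (sum4 (conv (re_pos ze) (re_neg mu)) (conv (re_neg ze) (re_pos mu))
          (conv (im_pos ze) (im_pos mu)) (conv (im_neg ze) (im_neg mu)))
    (sum4 (conv (re_pos ze) (im_pos mu)) (conv (re_neg ze) (im_neg mu))
          (conv (im_pos ze) (re_pos mu)) (conv (im_neg ze) (re_neg mu)))
    (sum4 (conv (re_pos ze) (im_neg mu)) (conv (re_neg ze) (im_pos mu))
          (conv (im_pos ze) (re_neg mu)) (conv (im_neg ze) (re_pos mu))).
Proof.
set P := sum4 _ _ _ _; set Q := sum4 _ _ _ _; set S := sum4 _ _ _ _; set T := sum4 _ _ _ _.
have intE (E : set (borel G)) : measurable E ->
    cm_int ze (fun x : G => cm_val mu [set y : G | E (x * y)%g]) =
    (fine (P E) - fine (Q E)) +i* (fine (S E) - fine (T E)).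
  move=> mE.
  have [i1 e1] := Cint_ltrans (re_pos ze) mu mE.
  have [i2 e2] := Cint_ltrans (re_neg ze) mu mE.
  have [i3 e3] := Cint_ltrans (im_pos ze) mu mE.
  have [i4 e4] := Cint_ltrans (im_neg ze) mu mE.
  rewrite [LHS](cm_int_is (cm_is_jordan G_hausdorff ze) i1 i2 i3 i4) e1 e2 e3 e4.
  rewrite /P /Q /S /T !sum4_fine//.
  by apply: complexP => /=; ring.
have : [set la | forall E : set (borel G), measurable E ->
    cm_val la E = cm_int ze (fun x : G => cm_val mu [set y : G | E (x * y)%g])] (convol ze mu).
  apply: xgetPex; exists (mkcm G_hausdorff P Q S T) => E mE; rewrite intE//.
  have [re im] := mkcm_is G_hausdorff P Q S T mE.
  by rewrite /cm_val /cval re im !fineB ?rm_fin.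
move=> H E mE; have {}H := H E mE; rewrite intE// in H.
have re : fine (cm_re (convol ze mu) E) = fine (P E) - fine (Q E) := congr1 (@complex.Re R) H.
have im : fine (cm_im (convol ze mu) E) = fine (S E) - fine (T E) := congr1 (@complex.Im R) H.
have fre : cm_re (convol ze mu) E \is a fin_num by exact: fin_num_measure.
have fim : cm_im (convol ze mu) E \is a fin_num by exact: fin_num_measure.
split.
- by rewrite -[LHS]fineK// re EFinB !fineK ?rm_fin.
- by rewrite -[LHS]fineK// im EFinB !fineK ?rm_fin.
Qed.

Lemma rm_clinear_sum4 phi a b c d : rm_clinear phi ->
  phi (sum4 a b c d) = phi a + phi b + (phi c + phi d).
Proof.
move=> lin; rewrite (rm_clinearD (a := radd a b) (b := radd c d) lin); last first.
  by move=> E _; exact: raddE.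
rewrite (rm_clinearD (a := a) (b := b) (c := radd a b) lin); last by move=> E _; exact: raddE.
by rewrite (rm_clinearD (a := c) (b := d) (c := radd c d) lin)// => E _; exact: raddE.
Qed.

Lemma ext_convol phi ze mu : rm_clinear phi ->
  ext phi (convol ze mu) = ext (fun m => ext (fun z => phi (conv z m)) ze) mu.
Proof.
move=> lin.
rewrite (ext_is G_hausdorff lin (convol_is ze mu)) !rm_clinear_sum4// /ext.
(* [ring] does not know that i squares to -1: with a variable [j] for i, the two sides differ by a
   multiple of [j * j + 1]. *)
have key (j aa ab ac ad ba bb bc bd ca cb cc cd da db dc dd : R[i]) : j * j = -1 ->
    aa + bb + (cd + dc) - (ab + ba + (cc + dd)) +
      j * (ac + bd + (ca + db) - (ad + bc + (cb + da))) =
    aa - ba + j * (ca - da) - (ab - bb + j * (cb - db)) +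
      j * (ac - bc + j * (cc - dc) - (ad - bd + j * (cd - dd))).
  move=> j2; apply/eqP; rewrite -subr_eq0; apply/eqP.
  transitivity ((j * j + 1) * (dc + cd - cc - dd)); first by ring.
  by rewrite j2 addNr mul0r.
by apply: key; rewrite -expr2 sqr_i.
Qed.

(** Both sides are the same finite sum over Jordan parts, so the order can be exchanged by algebra
    alone; the right action calls for this. *)
Lemma ext_swap (k : rmeas R G -> rmeas R G -> R[i]) ze mu :
  ext (fun m => ext (fun z => k z m) ze) mu = ext (fun z => ext (fun m => k z m) mu) ze.
Proof. by rewrite /ext; ring. Qed.

End convolution.

(** * Introversion *)

Section functional_operations.
Context (R : realType) (G : topologicalGroupType).
Hypothesis G_hausdorff : hausdorff_space G.
Implicit Types (a b c d : rmeas R G) (mu nu : cmeasure R G).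
Implicit Types (f g : gfamily R G) (phi psi : rmeas R G -> R[i]).

Local Notation lam := (lam G_hausdorff).
Local Notation rrestr := (rrestr G_hausdorff).
Local Notation cm_of := (cm_of G_hausdorff).
Local Notation gfun := (gfun G_hausdorff).

Lemma rm_null_sub a (E F : set (borel G)) : measurable E -> measurable F ->
  E `<=` F -> a F = 0%E -> a E = 0%E.
Proof.
by move=> mE mF EF aF; apply/eqP; rewrite eq_le rm_ge0 andbT -aF rm_le.
Qed.

Lemma rrestr_split a (D : set (borel G)) (mD : measurable D) E : measurable E ->
  a E = (rrestr a mD E + rrestr a (measurableC mD) E)%E.
Proof.
move=> mE; rewrite !rrestrE -measureU; first by rewrite -setIUr setUv setIT.
- exact: measurableI.
- by apply: measurableI => //; exact: measurableC.
- by rewrite setIACA setICr setI0.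
Qed.

Lemma mass_rrestr_split a (D : set (borel G)) (mD : measurable D) :
  mass a = mass (rrestr a mD) + mass (rrestr a (measurableC mD)).
Proof. by apply: EFin_inj; rewrite EFinD !massE -rrestr_split. Qed.

Lemma mass_rrestr_le a (D : set (borel G)) (mD : measurable D) :
  mass (rrestr a mD) <= mass a.
Proof. by rewrite (mass_rrestr_split a mD) lerDl mass_ge0. Qed.

Lemma clinear_rrestr_split phi a (D : set (borel G)) (mD : measurable D) :
  rm_clinear phi -> phi a = phi (rrestr a mD) + phi (rrestr a (measurableC mD)).
Proof. by move=> lin; apply: rm_clinearD => // E mE; exact: rrestr_split. Qed.

Lemma rm_clinear_comb (u : R[i]) phi psi : rm_clinear phi -> rm_clinear psi ->
  rm_clinear (fun a => u * phi a + psi a).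
Proof.
move=> lphi lpsi t a b c t0 cE.
by rewrite (lphi _ _ _ _ t0 cE) (lpsi _ _ _ _ t0 cE); ring.
Qed.

Lemma rm_bounded_comb (u : R[i]) phi psi (B C : R) : rm_bounded phi B -> rm_bounded psi C ->
  rm_bounded (fun a => u * phi a + psi a) (normc u * B + C).
Proof.
move=> Bphi Cpsi a; rewrite (le_trans (le_normcD _ _))// mulrDl lerD// normcM -mulrA.
by rewrite ler_wpM2l// normc_ge0.
Qed.

Lemma GL0_functional_comb (u : R[i]) phi psi : GL0_functional phi -> GL0_functional psi ->
  GL0_functional (fun a => u * phi a + psi a).
Proof.
move=> [lphi [B B0 Bphi] vphi] [lpsi [C C0 Cpsi] vpsi]; split.
- exact: rm_clinear_comb.
- exists (normc u * B + C); last exact: rm_bounded_comb.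
  by rewrite addr_ge0// mulr_ge0// normc_ge0.
move=> e e0.
have u1 : 0 < normc u + 1 by rewrite ltr_wpDl// normc_ge0.
have [K cK HK] := vphi (e / 2 / (normc u + 1)) (divr_gt0 (divr_gt0 e0 (ltr0Sn _ 1)) u1).
have [L cL HL] := vpsi (e / 2) (divr_gt0 e0 (ltr0Sn _ 1)).
have mK := compact_borel G_hausdorff cK; have mL := compact_borel G_hausdorff cL.
have mKL := measurableU _ _ mK mL.
exists (K `|` L) => [|a aKL]; first exact: compactU.
have aK : a K = 0%E by apply: (rm_null_sub mK mKL _ aKL); exact: subsetUl.
have aL : a L = 0%E by apply: (rm_null_sub mL mKL _ aKL); exact: subsetUr.
rewrite (le_trans (le_normcD _ _))// normcM [e in leRHS]splitr mulrDl lerD ?HL//.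
apply: (@le_trans _ _ ((normc u + 1) * (e / 2 / (normc u + 1) * mass a))).
  by apply: ler_pM; rewrite ?normc_ge0// ?lerDl// HK.
by rewrite mulrA mulrCA divff ?mulr1// gt_eqF.
Qed.

Lemma GL0_functional0 : GL0_functional (fun _ : rmeas R G => 0).
Proof.
split.
- by move=> t a b c _ _; rewrite mulr0 addr0.
- by exists 0 => // a; rewrite normc0 mul0r.
- move=> e e0; exists set0 => [|a _]; first exact: compact0.
  by rewrite normc0 mulr_ge0 ?mass_ge0// ltW.
Qed.

Lemma GL0_functional_eq phi psi : (forall a, phi a = psi a) ->
  GL0_functional phi -> GL0_functional psi.
Proof. by move=> /funext ->. Qed.

Lemma rm_clinear_rrestr phi (D : set (borel G)) (mD : measurable D) :
  rm_clinear phi -> rm_clinear (fun a => phi (rrestr a mD)).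
Proof.
move=> lin t a b c t0 cE; apply: lin => // E mE.
by rewrite !rrestrE cE//; exact: measurableI.
Qed.

Lemma rm_bounded_rrestr phi (B : R) (D : set (borel G)) (mD : measurable D) : 0 <= B ->
  rm_bounded phi B -> rm_bounded (fun a => phi (rrestr a mD)) B.
Proof.
move=> B0 bnd a; rewrite (le_trans (bnd _))// ler_wpM2l//.
exact: mass_rrestr_le.
Qed.

Lemma GL0_functional_rrestr phi (D : set (borel G)) (mD : measurable D) :
  GL0_functional phi -> GL0_functional (fun a => phi (rrestr a mD)).
Proof.
move=> [lin [B B0 bnd] van]; split.
- exact: rm_clinear_rrestr.
- by exists B => //; exact: rm_bounded_rrestr.
move=> e e0; have [K cK HK] := van e e0; exists K => // a aK.
have mK := compact_borel G_hausdorff cK.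
rewrite (le_trans (HK _ _))//; last by rewrite ler_wpM2l ?mass_rrestr_le// ltW.
by apply/eqP; rewrite eq_le rm_ge0 andbT -aK rrestr_le.
Qed.

Lemma Cint_comb a (u : R[i]) (g h : borel G -> R[i]) : cintegrable a g -> cintegrable a h ->
  Cint a (fun x => u * g x + h x) = u * Cint a g + Cint a h.
Proof.
move=> [gR gI] [hR hI]; case: u => r s.
have E1 : (fun x => complex.Re ((r +i* s) * g x + h x)) =
    (fun x => r * complex.Re (g x) - s * complex.Im (g x) + complex.Re (h x)).
  by apply/funext => x; case: (g x) (h x) => [? ?] [? ?].
have E2 : (fun x => complex.Im ((r +i* s) * g x + h x)) =
    (fun x => r * complex.Im (g x) + s * complex.Re (g x) + complex.Im (h x)).
  by apply/funext => x; case: (g x) (h x) => [? ?] [? ?].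
have iZ k (v : borel G -> R) : a.-integrable setT (EFin \o v) ->
  a.-integrable setT (EFin \o (fun x => k * v x)).
  by move=> iv; have := integrableZl measurableT k iv.
have iD (v w : borel G -> R) : a.-integrable setT (EFin \o v) ->
  a.-integrable setT (EFin \o w) ->
    a.-integrable setT (EFin \o (fun x => v x + w x)).
  by move=> iv iw; have := integrableD measurableT iv iw.
have iB (v w : borel G -> R) : a.-integrable setT (EFin \o v) ->
  a.-integrable setT (EFin \o w) ->
    a.-integrable setT (EFin \o (fun x => v x - w x)).
  by move=> iv iw; have := integrableB measurableT iv iw.
rewrite /Cint E1 E2; apply: complexP => /=.
- by rewrite RintegralD ?RintegralB ?RintegralZl//; [apply: iZ|apply: iZ|apply: iB; apply: iZ].
- by rewrite !RintegralD ?RintegralZl//; [apply: iZ|apply: iZ|apply: iD; apply: iZ].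
Qed.

Lemma GL_comb (u : R[i]) f g : GL f -> GL g ->
  GL (fun mu x => u * f mu x + g mu x) /\
  forall a, gfun (fun mu x => u * f mu x + g mu x) a = u * gfun f a + gfun g a.
Proof.
move=> fG gG; have [fL fae] := fG; have [gL gae] := gG; split; last first.
  move=> a; have aa : a `<< lam (cm_of a) by apply: le_lam_cm_of.
  by apply: Cint_comb; [case: (GL_dominated fG aa)|case: (GL_dominated gG aa)].
split=> [mu|mu nu dom]; last first.
  apply/(ae_tv G_hausdorff).
  move: (fae _ _ dom) (gae _ _ dom) => /(ae_tv G_hausdorff) + /(ae_tv G_hausdorff).
  by apply: filterS2 => x + + _ => -> // ->.
have [B B0 fB] := Linf_ae_bound G_hausdorff (fL mu).
have [C C0 gC] := Linf_ae_bound G_hausdorff (gL mu).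
have [[fR fI] _] := fL mu; have [[gR gI] _] := gL mu.
split.
  split.
  - rewrite (_ : (fun x => _) = (fun x => complex.Re u * complex.Re (f mu x) -
        complex.Im u * complex.Im (f mu x) + complex.Re (g mu x))).
      by apply: measurable_funD => //; apply: measurable_funB; apply: measurable_funM.
    by apply/funext => x; case: u (f mu x) (g mu x) => [? ?] [? ?] [? ?].
  - rewrite (_ : (fun x => _) = (fun x => complex.Re u * complex.Im (f mu x) +
        complex.Im u * complex.Re (f mu x) + complex.Im (g mu x))).
      by apply: measurable_funD => //; apply: measurable_funD; apply: measurable_funM.
    by apply/funext => x; case: u (f mu x) (g mu x) => [? ?] [? ?] [? ?].
apply: (@le_lt_trans _ _ (normc u * B + C)%:E); last by rewrite ltry.
apply: (Linf_norm_le (G_hausdorff := G_hausdorff)).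
  by rewrite addr_ge0// mulr_ge0// normc_ge0.
apply: filterS2 fB gC => x fx gx.
by rewrite (le_trans (le_normcD _ _))// lerD// normcM ler_wpM2l// normc_ge0.
Qed.

Lemma GL0_comb (u : R[i]) f g : GL0 f -> GL0 g -> GL0 (fun mu x => u * f mu x + g mu x).
Proof.
move=> f0 g0; have [fgG fgE] := GL_comb u f0.1 g0.1.
apply: (GL0_of_gfun fgG fgE).
by have [_ _] := GL0_functional_comb u (GL0_gfun G_hausdorff f0) (GL0_gfun G_hausdorff g0).
Qed.

End functional_operations.

(** * Elements of the dual of GL_0(G), acting on functionals of positive measures *)

Section dual_on_functionals.
Context (R : realType) (G : topologicalGroupType).
Hypothesis G_hausdorff : hausdorff_space G.
Implicit Types (a b c d : rmeas R G) (mu nu : cmeasure R G).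
Implicit Types (f g : gfamily R G) (phi psi : rmeas R G -> R[i]).
Context (m : gfamily R G -> R[i]).
Hypothesis m_dual : GL0_dual m.

Local Notation ext := (ext G_hausdorff).
Local Notation gfun := (gfun G_hausdorff).

(** [GL_of] picks some representative of [phi]; [dual_eq] makes the choice immaterial when [phi] is
    a [GL0_functional]. *)
Definition dual_fun phi : R[i] := m (GL_of (ext phi)).

Lemma dual_bound : exists2 C : R, 0 <= C & forall f B, GL0 f -> 0 <= B ->
  rm_bounded (gfun f) B -> normc (m f) <= C * B.
Proof.
(* The absolute value because [C] comes without a sign, twice because [GL_norm_le] bounds the norm
   by [B + B]. *)
have [_ [C HC]] := m_dual; exists (`|C| + `|C|) => [|f B f0 B0 fB]; first by rewrite addr_ge0.
have N := GL_norm_le f0.1 B0 fB.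
have N0 : (0 <= GL_norm f)%E.
  apply: le_trans (ereal_sup_ubound _); last by exists (cm0 R G).
  by apply: le_ereal_inf_tmp => _ [b [b0 _] <-]; rewrite lee_fin.
have : ((normc (m f))%:E <= `|C|%:E * (B + B)%:E)%E.
  apply: (le_trans (HC f f0)); apply: (@le_trans _ _ (`|C|%:E * GL_norm f)%E).
    by rewrite lee_wpmul2r// lee_fin ler_norm.
  by rewrite lee_wpmul2l// lee_fin.
by rewrite -EFinM lee_fin; lra.
Qed.

(** The difference g - f induces the zero functional, so boundedness and linearity of [m] give m g -
    m f = 0. *)
Lemma dual_eq f g : GL0 f -> GL0 g -> (forall a, gfun f a = gfun g a) -> m f = m g.
Proof.
move=> f0 g0 fg; have [C C0 HC] := dual_bound.
have h0 := GL0_comb G_hausdorff (-1) f0 g0.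
have [_ hE] := GL_comb G_hausdorff (-1) f0.1 g0.1.
have /HC : rm_bounded (gfun (fun mu x => -1 * f mu x + g mu x)) 0.
  by move=> a; rewrite hE fg mulN1r addNr normc0 mul0r.
move=> /(_ h0 (lexx _)); rewrite m_dual.1// mulr0 => le0.
have : normc (-1 * m f + m g) = 0 by apply/eqP; rewrite eq_le le0 normc_ge0.
by move/eq0_normc/eqP; rewrite mulN1r addrC subr_eq0 => /eqP.
Qed.

(** The representative chosen for the combination and the combination of the chosen representatives
    may differ as families, but induce the same functional. *)
Lemma dual_fun_comb (u : R[i]) phi psi : GL0_functional phi -> GL0_functional psi ->
  dual_fun (fun a => u * phi a + psi a) = u * dual_fun phi + dual_fun psi.
Proof.
move=> phi0 psi0.
have c0 := GL0_functional_comb G_hausdorff u phi0 psi0.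
have gE psi' : GL0_functional psi' -> forall a, gfun (GL_of (ext psi')) a = psi' a.
  by move=> [lin bnd _]; exact: gfun_GL_of.
rewrite /dual_fun -m_dual.1; try exact: GL0_GL_of.
have F0 := GL0_GL_of G_hausdorff phi0; have P0 := GL0_GL_of G_hausdorff psi0.
apply: dual_eq; [exact: GL0_GL_of|exact: GL0_comb|move=> a].
rewrite gE//; have [_ ->] := GL_comb G_hausdorff u F0.1 P0.1.
by rewrite !gE.
Qed.

Lemma dual_fun_bound : exists2 C : R, 0 <= C & forall phi B, GL0_functional phi -> 0 <= B ->
  rm_bounded phi B -> normc (dual_fun phi) <= C * B.
Proof.
have [C C0 HC] := dual_bound; exists C => // phi B phi0 B0 bnd.
apply: HC => //; first exact: GL0_GL_of.
by case: phi0 => lin bnd' _ a; rewrite gfun_GL_of.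
Qed.

Lemma dual_funD phi psi : GL0_functional phi -> GL0_functional psi ->
  dual_fun (fun a => phi a + psi a) = dual_fun phi + dual_fun psi.
Proof.
move=> phi0 psi0; rewrite -[X in _ = X + _]mul1r -dual_fun_comb//.
by congr dual_fun; apply/funext => a; rewrite mul1r.
Qed.

Lemma dual_fun0 : dual_fun (fun=> 0) = 0.
Proof.
have [C _ /(_ (fun=> 0) 0 (GL0_functional0 R G) (lexx _))] := dual_fun_bound.
rewrite mulr0 => H; apply: eq0_normc; apply/eqP; rewrite eq_le normc_ge0 andbT H//.
by move=> a; rewrite normc0 mul0r.
Qed.

Lemma dual_funZ (u : R[i]) phi : GL0_functional phi ->
  dual_fun (fun a => u * phi a) = u * dual_fun phi.
Proof.
move=> phi0; rewrite -[RHS]addr0 -dual_fun0 -dual_fun_comb//; last exact: GL0_functional0.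
by congr dual_fun; apply/funext => a; rewrite addr0.
Qed.

(** [ext] combines four values with coefficients 1, -1, i and -i, so linearity of [m] is enough to
    move it inside. *)
Lemma dual_fun_ext (k : rmeas R G -> rmeas R G -> R[i]) mu :
  (forall z, GL0_functional (k z)) ->
  dual_fun (fun a => ext (fun z => k z a) mu) = ext (fun z => dual_fun (k z)) mu.
Proof.
move=> kz; have kN z z' := GL0_functional_comb G_hausdorff (-1) (kz z) (kz z').
have -> : (fun a => ext (fun z => k z a) mu) = (fun a =>
    'i%C * (-1 * k (im_neg G_hausdorff mu) a + k (im_pos G_hausdorff mu) a) +
    (-1 * k (re_neg G_hausdorff mu) a + k (re_pos G_hausdorff mu) a)).
  by apply/funext => a; rewrite /ext; ring.
by rewrite !dual_fun_comb// /ext; ring.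
Qed.

End dual_on_functionals.

(** * Concentration of the dual on compact sets *)

Section concentration.
Context (R : realType) (G : topologicalGroupType).
Hypothesis G_hausdorff : hausdorff_space G.
Implicit Types (a : rmeas R G) (phi psi : rmeas R G -> R[i]).
Context (m : gfamily R G -> R[i]).
Hypothesis m_dual : GL0_dual m.

Local Notation rrestr := (rrestr G_hausdorff).
Local Notation dual_fun := (dual_fun G_hausdorff m).

Lemma rm_clinear_null phi a : rm_clinear phi -> a setT = 0%E -> phi a = 0.
Proof.
move=> lin aT; rewrite -(rm_clinear0 lin); apply: rm_clinear_ext => // E mE.
by apply: (rm_null_sub (a := a) mE measurableT).
Qed.

(* A functional of norm one which lives on a compact set and nearly maximises
   Re m cannot be improved by adding one which lives on a disjoint set. *)
Lemma dual_fun_gap (e : R) : 0 < e -> exists2 K : set G, compact K &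
  forall g, GL0_functional g -> rm_bounded g 1 ->
    (forall a, a (~` K) = 0%E -> g a = 0) ->
    (exists2 L : set G, compact L & forall a, a L = 0%E -> g a = 0) ->
    complex.Re (dual_fun g) <= e.
Proof.
move=> e0; have [C C0 HC] := dual_fun_bound G_hausdorff m_dual.
pose supported g := exists2 L : set G, compact L & forall a, a L = 0%E -> g a = 0 :> R[i].
pose S := [set x : R | exists g, [/\ GL0_functional g, rm_bounded g 1,
  supported g & x = complex.Re (dual_fun g)]].
have Sub : ubound S (C * 1).
  move=> _ [g [g0 g1 _ ->]]; apply: (le_trans (ler_norm _)).
  exact: le_trans (ge_Re_normc _) (HC _ _ g0 ler01 g1).
have Sne : S !=set0.
  exists (complex.Re (dual_fun (fun=> 0))), (fun=> 0); split => //.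
  - exact: GL0_functional0.
  - by move=> a; rewrite normc0 mul1r mass_ge0.
  - by exists set0 => //; exact: compact0.
have hsS : has_sup S by split => //; exists (C * 1).
(* [phi] comes within [e] of the supremum, and its support is the compact set sought: a larger
   contribution from [g] would push the sum past the supremum. *)
have [_ [phi [phi0 phi1 [K cK phiK] ->]] lt] := sup_adherent e0 hsS.
exists K => // g g0 g1 gK [L cL gL].
have mK := compact_borel G_hausdorff cK; have mL := compact_borel G_hausdorff cL.
have mKL := measurableU _ _ mK mL.
suff /(sup_ubound hsS.2) : S (complex.Re (dual_fun phi) + complex.Re (dual_fun g)).
  by move=> le; lra.
exists (fun a => phi a + g a); split.
- have := GL0_functional_comb G_hausdorff 1 phi0 g0.
  by apply: GL0_functional_eq => a; rewrite mul1r.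
(* [phi] sees only the part of [a] on [K] and [g] only the rest; the masses of the two parts add up
   to that of [a], so the bound 1 persists. *)
- move=> a; case: (phi0) => lphi _ _; case: (g0) => lg _ _.
  rewrite (clinear_rrestr_split G_hausdorff a mK lphi) (clinear_rrestr_split G_hausdorff a mK
    lg).
  rewrite (phiK (rrestr a (measurableC mK))); last by rewrite rrestrE setICr measure0.
  rewrite (gK (rrestr a mK)); last by rewrite rrestrE setICl measure0.
  rewrite addr0 add0r (le_trans (le_normcD _ _))// (mass_rrestr_split G_hausdorff a mK) mulrDr.
  by rewrite lerD// ?phi1// g1.
- exists (K `|` L) => [|a aKL]; first exact: compactU.
  rewrite phiK ?gL ?addr0//.
  + by apply: (rm_null_sub mL mKL _ aKL); exact: subsetUr.
  + by apply: (rm_null_sub mK mKL _ aKL); exact: subsetUl.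
- by rewrite dual_funD//; case: (dual_fun phi) (dual_fun g) => [? ?] [? ?].
Qed.

(** The bound on the real part, applied to [g] multiplied by 1, -1, i and -i, bounds both parts of
    the value by [e / 2]. *)
Lemma dual_fun_gap_norm (e : R) : 0 < e -> exists2 K : set G, compact K &
  forall g, GL0_functional g -> rm_bounded g 1 ->
    (forall a, a (~` K) = 0%E -> g a = 0) ->
    (exists2 L : set G, compact L & forall a, a L = 0%E -> g a = 0) ->
    normc (dual_fun g) <= e.
Proof.
move=> e0; have [K cK HK] := dual_fun_gap (divr_gt0 e0 (ltr0Sn _ 1)).
exists K => // g g0 g1 gK [L cL gL].
have rot (u : R[i]) : normc u = 1 -> complex.Re (u * dual_fun g) <= e / 2.
  move=> u1; rewrite -dual_funZ//; apply: HK.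
  - have := GL0_functional_comb G_hausdorff u g0 (GL0_functional0 R G).
    by apply: GL0_functional_eq => a; rewrite addr0.
  - by move=> a; rewrite normcM u1 mul1r.
  - by move=> a aK; rewrite gK// mulr0.
  - by exists L => // a aL; rewrite gL// mulr0.
have n1 : normc (1 : R[i]) = 1 by rewrite normc1.
have ni : normc ('i%C : R[i]) = 1 by rewrite /= expr0n expr1n add0r sqrtr1.
have r1 := rot 1 n1; have r2 := rot (-1) (etrans (normcN _) n1).
have r3 := rot 'i%C ni; have r4 := rot (- 'i%C) (etrans (normcN _) ni).
rewrite (le_trans (normc_le_add _))//; move: r1 r2 r3 r4.
case: (dual_fun g) => x y /= r1 r2 r3 r4.
have xe : `|x| <= e / 2 by rewrite ler_norml; lra.
have ye : `|y| <= e / 2 by rewrite ler_norml; lra.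
by lra.
Qed.

(** [K] is fixed before [phi]. Off [K], [phi] is cut along a compact [L] outside which it is small:
    the piece on [L] falls under [dual_fun_gap_norm], the other under the boundedness of [m]. *)
Lemma dual_fun_concentrated (e : R) : 0 < e ->
  exists K : set G, compact K /\ forall (mKC : measurable (~` K : set (borel G))) phi B,
    GL0_functional phi -> 0 <= B -> rm_bounded phi B ->
    normc (dual_fun (fun a => phi (rrestr a mKC))) <= e * B.
Proof.
move=> e0; have [C C0 HC] := dual_fun_bound G_hausdorff m_dual.
have C1 : 0 < C + 1 by rewrite ltr_wpDl.
(* Makes the two contributions [d] and [C * d] add up to [e]. *)
pose d := e / (C + 1); have d0 : 0 < d by rewrite divr_gt0.
have [K cK HK] := dual_fun_gap_norm d0.
exists K; split => // mKC.
have unit phi : GL0_functional phi -> rm_bounded phi 1 ->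
    normc (dual_fun (fun a => phi (rrestr a mKC))) <= e.
  move=> phi0 phi1; have [lin _ van] := phi0; have [L cL HL] := van d d0.
  have mL := compact_borel G_hausdorff cL; pose mLC := measurableC mL.
  pose g a := phi (rrestr (rrestr a mKC) mL).
  pose h a := phi (rrestr (rrestr a mKC) mLC).
  have r0 := GL0_functional_rrestr G_hausdorff mL phi0.
  have rC0 := GL0_functional_rrestr G_hausdorff mLC phi0.
  have g0 : GL0_functional g by exact: (GL0_functional_rrestr G_hausdorff mKC r0).
  have h0 : GL0_functional h by exact: (GL0_functional_rrestr G_hausdorff mKC rC0).
  have -> : (fun a => phi (rrestr a mKC)) = (fun a => g a + h a).
    by apply/funext => a; exact: clinear_rrestr_split.
  rewrite dual_funD// (le_trans (le_normcD _ _))//.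
  have ge : normc (dual_fun g) <= d.
    apply: HK => //.
    - apply: (rm_bounded_rrestr G_hausdorff mKC ler01 (phi := fun a => phi (rrestr a mL))).
      exact: rm_bounded_rrestr.
    - move=> a aK; apply: (rm_clinear_null lin).
      rewrite !rrestrE setTI; apply: (rm_null_sub (a := a) _ mKC _ aK).
        exact: measurableI.
      exact: subIsetr.
    - exists L => // a aL; apply: (rm_clinear_null lin).
      rewrite !rrestrE setTI; apply: (rm_null_sub (a := a) _ mL _ aL).
        exact: measurableI.
      exact: subIsetl.
  have he : normc (dual_fun h) <= C * d.
    apply: HC => //; first exact: ltW.
    move=> a; rewrite (le_trans (HL _ _))//.
      by rewrite !rrestrE setICr set0I measure0.
    rewrite ler_wpM2l//; first exact: ltW.
    by rewrite (le_trans (mass_rrestr_le _ _ _))// mass_rrestr_le.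
  rewrite (le_trans (lerD ge he))// -[X in X + _]mul1r -mulrDl addrC /d.
  by rewrite mulrCA divff ?mulr1// gt_eqF.
move=> phi B phi0 B0 phiB.
(* The general bound is rescaled to 1, which is impossible for [B = 0]. *)
have [B_eq0|Bn0] := eqVneq B 0.
  rewrite B_eq0 mulr0 -(mulr0 C); apply: HC => //; first exact: GL0_functional_rrestr.
  by apply: rm_bounded_rrestr => //; rewrite -B_eq0.
have Bp : 0 < B by rewrite lt_neqAle eq_sym Bn0.
pose u : R[i] := (B^-1)%:C.
have nu : normc u = B^-1 by rewrite /= expr0n addr0 sqrtr_sqr ger0_norm// invr_ge0.
have uphi0 : GL0_functional (fun a => u * phi a).
  have := GL0_functional_comb G_hausdorff u phi0 (GL0_functional0 R G).
  by apply: GL0_functional_eq => a; rewrite addr0.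
have uphi1 : rm_bounded (fun a => u * phi a) 1.
  move=> a; rewrite normcM nu mul1r -ler_pdivlMl ?invr_gt0// invrK; exact: phiB.
have := unit _ uphi0 uphi1; rewrite dual_funZ//; last exact: GL0_functional_rrestr.
by rewrite normcM nu -ler_pdivlMl ?invr_gt0// invrK mulrC.
Qed.

End concentration.

(* op and rop stand for the convolution, or for the convolution with swapped arguments,
   of complex and of positive measures. *)
Section introversion.
Context (R : realType) (G : topologicalGroupType).
Hypothesis G_hausdorff : hausdorff_space G.
Implicit Types (a b c d z : rmeas R G) (ze mu : cmeasure R G).
Implicit Types (f : gfamily R G) (phi : rmeas R G -> R[i]).

Local Notation rrestr := (rrestr G_hausdorff).
Local Notation ext := (ext G_hausdorff).
Local Notation gfun := (gfun G_hausdorff).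

Context (op : cmeasure R G -> cmeasure R G -> cmeasure R G).
Context (rop : rmeas R G -> rmeas R G -> rmeas R G).
Hypothesis rop_linl : forall (t : R) a b c d, 0 <= t ->
  (forall E, measurable E -> c E = (t%:E * a E + b E)%E) ->
  forall E, measurable E -> rop c d E = (t%:E * rop a d E + rop b d E)%E.
Hypothesis rop_linr : forall (t : R) a b c d, 0 <= t ->
  (forall E, measurable E -> c E = (t%:E * a E + b E)%E) ->
  forall E, measurable E -> rop d c E = (t%:E * rop d a E + rop d b E)%E.
Hypothesis mass_rop : forall a b, mass (rop a b) = mass a * mass b.
Hypothesis rop_support : forall C D : set G, compact C -> compact D ->
  exists2 K : set G, compact K & forall a b,
    (a K = 0%E /\ b (~` C) = 0%E) \/ (a (~` C) = 0%E /\ b K = 0%E) ->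
    rop a b D = 0%E.
Hypothesis pairing_op : forall f ze mu, GL f ->
  pairing f (op ze mu) = ext (fun b => ext (fun z => gfun f (rop z b)) ze) mu.

Lemma rop_bounded F (B : R) z : 0 <= B -> rm_bounded F B ->
  rm_bounded (fun b => F (rop z b)) (B * mass z).
Proof. by move=> B0 bnd b; rewrite (le_trans (bnd _))// mass_rop mulrA. Qed.

(** This puts ze o f and f o ze into GL_0(G). [F] is small off a compact [D], and [z], being
    regular, is nearly carried by a compact [C]; [rop_support] turns the pair into a compact set for
    the new functional. *)
Lemma rop_GL0_functional F z : GL0_functional F -> GL0_functional (fun b => F (rop z b)).
Proof.
move=> [lin [B B0 bnd] van]; split.
- by move=> t a b c t0 cE; apply: lin => //; exact: rop_linr.
- by exists (B * mass z); [rewrite mulr_ge0 ?mass_ge0|exact: rop_bounded].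
move=> e e0.
have z1 : 0 < 2 * (mass z + 1) by rewrite mulr_gt0// ltr_wpDl ?mass_ge0.
have B1 : 0 < 2 * (B + 1) by rewrite mulr_gt0// ltr_wpDl.
(* [e1] is spent on the part of [z] on [C], [e2] on the rest, each at a cost of at most half of [e];
   the added 1 allows [mass z = 0] or [B = 0]. *)
pose e1 := e / (2 * (mass z + 1)); have e10 : 0 < e1 by rewrite divr_gt0.
pose e2 := e / (2 * (B + 1)); have e20 : 0 < e2 by rewrite divr_gt0.
have [D cD HD] := van e1 e10.
have [C [V [cC oV _ TV zC]]] := @rm_regular _ _ z setT e2 measurableT e20.
have mC := compact_borel G_hausdorff cC; pose mCC := measurableC mC.
have [K cK HK] := rop_support cC cD.
exists K => // b bK.
have linl : rm_clinear (fun z => F (rop z b)).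
  by move=> t a a' c t0 cE; apply: lin => //; exact: rop_linl.
rewrite (clinear_rrestr_split G_hausdorff z mC linl) (le_trans (le_normcD _ _))//.
have n1 : normc (F (rop (rrestr z mC) b)) <= e / 2 * mass b.
  rewrite (le_trans (HD _ _))//.
    by apply: HK; right; split => //; rewrite rrestrE setICl measure0.
  rewrite mass_rop mulrA ler_wpM2r ?mass_ge0//.
  apply: (@le_trans _ _ (e1 * (mass z + 1))).
    rewrite ler_wpM2l ?(ltW e10)//.
    by rewrite (le_trans (mass_rrestr_le G_hausdorff z mC))// lerDl.
  rewrite /e1 le_eqVlt; apply/orP; left; apply/eqP; field.
  by rewrite gt_eqF// ltr_wpDl ?mass_ge0.
have n2 : normc (F (rop (rrestr z mCC) b)) <= e / 2 * mass b.
  rewrite (le_trans (bnd _))// mass_rop mulrA ler_wpM2r ?mass_ge0//.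
  have zle : mass (rrestr z mCC) <= e2.
    rewrite -lee_fin massE; apply: ltW; apply: le_lt_trans zC.
    rewrite rrestrE setTI; apply: rm_le => //.
      by apply: measurableD => //; exact: open_borel.
    by move=> x nCx; split => //; exact: TV.
  apply: (@le_trans _ _ ((B + 1) * e2)).
    by apply: ler_pM; rewrite ?mass_ge0// lerDl.
  rewrite /e2 le_eqVlt; apply/orP; left; apply/eqP; field.
  by rewrite gt_eqF// ltr_wpDl.
rewrite (le_trans (lerD n1 n2))// -mulrDl.
by rewrite -splitr.
Qed.

(** Moving [m] inside [ext] turns the functional into [ext psi], with [psi z] the value of [m] at b
    |-> F (rop z b). The claim then concerns [psi] on positive measures alone. *)
Lemma introverted m f : GL0_dual m -> GL0 f ->
  in_GL0 (fun ze => m (GL_of (fun mu => pairing f (op ze mu)))).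
Proof.
move=> m_dual f0; pose F := gfun f.
have F0 : GL0_functional F by exact: GL0_gfun.
have [lin [B B0 bnd] van] := F0.
pose phi z b := F (rop z b).
have phi0 z : GL0_functional (phi z) by exact: rop_GL0_functional.
pose psi z := dual_fun G_hausdorff m (phi z).
have -> : (fun ze => m (GL_of (fun mu => pairing f (op ze mu)))) = ext psi.
  apply/funext => ze; rewrite /psi -dual_fun_ext// /dual_fun.
  by congr (m (GL_of _)); apply/funext => mu; exact: pairing_op f0.1.
have [C C0 HC] := dual_fun_bound G_hausdorff m_dual.
have psi0 : GL0_functional psi.
  split.
  - move=> t a b c t0 cE; rewrite /psi -dual_fun_comb//.
    congr (dual_fun _ _ _); apply/funext => d.
    by apply: lin => //; exact: rop_linl.
  - exists (C * B); first exact: mulr_ge0.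
    move=> z; rewrite -mulrA; apply: HC => //; first by rewrite mulr_ge0 ?mass_ge0.
    exact: rop_bounded.
  move=> e e0.
  have B1 : 0 < 2 * (B + 1) by rewrite mulr_gt0// ltr_wpDl.
  have C1 : 0 < 2 * (C + 1) by rewrite mulr_gt0// ltr_wpDl.
  pose e1 := e / (2 * (B + 1)); have e10 : 0 < e1 by rewrite divr_gt0.
  pose e2 := e / (2 * (C + 1)); have e20 : 0 < e2 by rewrite divr_gt0.
  have [K0 [cK0 HK0]] := dual_fun_concentrated G_hausdorff m_dual e10.
  have [D cD HD] := van e2 e20.
  have [K cK HK] := rop_support cK0 cD.
  have mK0 := compact_borel G_hausdorff cK0; pose mK0C := measurableC mK0.
  exists K => // z zK.
  pose g b := phi z (rrestr b mK0); pose h b := phi z (rrestr b mK0C).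
  have g0 : GL0_functional g by exact: GL0_functional_rrestr.
  have h0 : GL0_functional h by exact: GL0_functional_rrestr.
  have -> : psi z = dual_fun G_hausdorff m g + dual_fun G_hausdorff m h.
    rewrite -dual_funD//; congr (dual_fun _ _ _); apply/funext => b.
    by case: (phi0 z) => linz _ _; exact: clinear_rrestr_split.
  rewrite (le_trans (le_normcD _ _))//.
  (* [K0] and [D] were fixed before [z]. As [z] is null on [K] and the restriction of [b] is carried
     by [K0], the convolution is null on [D], and off [D] the functional [F] is small. *)
  have ng : normc (dual_fun G_hausdorff m g) <= C * (e2 * mass z).
    apply: HC => //; first by rewrite mulr_ge0 ?mass_ge0// ltW.
    move=> b; rewrite (le_trans (HD _ _))//.
      by apply: HK; left; split => //; rewrite rrestrE setICl measure0.
    rewrite mass_rop mulrA ler_wpM2l ?mass_rrestr_le//.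
    by rewrite mulr_ge0 ?mass_ge0// ltW.
  have nh : normc (dual_fun G_hausdorff m h) <= e1 * (B * mass z).
    apply: HK0 => //; first by rewrite mulr_ge0 ?mass_ge0.
    exact: rop_bounded.
  rewrite (le_trans (lerD ng nh))// mulrA [e1 * _]mulrA -mulrDl ler_wpM2r ?mass_ge0//.
  have k1 : C * e2 <= e / 2.
    by rewrite /e2 mulrA ler_pdivrMr//; nra.
  have k2 : e1 * B <= e / 2.
    by rewrite /e1 mulrAC ler_pdivrMr//; nra.
  by rewrite [leRHS]splitr lerD.
exists (GL_of (ext psi)); first exact: GL0_GL_of.
by have [lpsi bpsi _] := psi0; exact: GL_of_functional.
Qed.

End introversion.

Theorem proposition4p1 (R : realType) (G : topologicalGroupType)
    (G_hausdorff : hausdorff_space G)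
    (G_locally_compact : locally_compact [set: G]%classic) :
  left_introverted R G /\ right_introverted R G.
Proof.
split=> m f m_dual f0.
- apply: (introverted (op := fun ze mu => convol ze mu)
    (rop := rconv G_hausdorff G_locally_compact)) => //.
  + exact: rconv_linl.
  + exact: rconv_linr.
  + exact: mass_rconv.
  + exact: rconv_support.
  + by move=> f' ze mu fG; rewrite pairing_ext// ext_convol//; exact: gfun_clinear.
(* With the arguments swapped, the two linearity conditions trade places, and so do the two cases of
   the support condition. *)
- apply: (introverted (op := fun ze mu => convol mu ze)
    (rop := fun a b => rconv G_hausdorff G_locally_compact b a)) => //.
  + by move=> t a b c d t0 cE; exact: rconv_linr.
  + by move=> t a b c d t0 cE; exact: rconv_linl.
  + by move=> a b; rewrite mass_rconv mulrC.
  + move=> C D cC cD; have [K cK HK] :=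
    @rconv_support R G G_hausdorff G_locally_compact C D cC cD.
    by exists K => // a b [[aK bC]|[aC bK]]; apply: HK; [right|left].
  (* [ext_convol] delivers the extensions in the two variables in the opposite order. *)
  + move=> f' ze mu fG; rewrite pairing_ext// ext_convol; last exact: gfun_clinear.
    exact: ext_swap.
Qed.
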